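(* Let $\mu$ have only even entries, let $\mathcal C$ be an admissible configuration of type II for $\mathcal H(\mu)$, and let $(C,\eta)\in\Delta(\mu,\mathcal C)$. Suppose $\eta$ has even order at all non-separating nodes of $C$. Then the parity of the limit spin structure on $(C,\eta)$ is $$\phi(C,\eta)=\sum_{i=1}^p\phi(C_i,\eta_{C_i})\pmod 2,$$ where $C_1,\dots,C_p$ are the non-rational components of $C$.
   Context: $\mathcal H(\mu)$, $\mu=(m_1,\dots,m_n)$, is the stratum of holomorphic differentials on genus $g$ Riemann surfaces with labelled zeros $\sigma_1,\dots,\sigma_n$ of orders $m_i$, $\sum m_i=2g-2$. Configurations of type II. $\mathcal C=(L,\{a_i,b_i\},\{c'_j,c''_j\})$: a surface has this configuration if it has precisely $m$ homologous closed saddle connections $\gamma_1,\dots,\gamma_m$, each joining a zero to itself. The $\gamma_l$ with $l\in L$ bound $q$ cylinders; after removing these cylinders and all $\gamma_k$ there remain $p=m-q$ disjoint surfaces $C_1,\dots,C_p$ of genus $\ge1$ (total genus $g-1$), where the boundary of the closure of $C_k$ consists of two closed saddle connections $\alpha_k,\beta_k$; they are glued in a cyclic order, $C_k$ being connected to $C_{k+1}$ by identifying $\alpha_k$ with $\beta_{k+1}$ or by inserting a metric cylinder. If $\alpha_i,\beta_i$ are disjoint (''pair of holes''), they contain one zero each, with angles $(2a_i+3)\pi$, $(2b_i+3)\pi$ inside $C_i$. If $\alpha_j\cup\beta_j$ is connected (''figure eight''), they contain the same zero and the two angles bounded by them inside $C_j$ are $2(c'_j+1)\pi$, $2(c''_j+1)\pi$;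 put $c_j=c_j'+c_j''$. Principal boundary. $\Delta(\mu,\mathcal C)$ is the space of limit twisted differentials of surfaces in $\mathcal H(\mu)$ with configuration $\mathcal C$, with $\gamma_i$ of length at most $\varepsilon$ and no other saddle connection shorter than $3\varepsilon$, as the $\gamma_i$ shrink to zero keeping the configuration so that the ratio of any other period to $\gamma_i$ becomes arbitrarily large (limit of pointed curves in $\overline{\mathcal M}_{g,n}$, and on each component the limit of suitably rescaled differentials). Explicitly, the curve $C$ has components $C_1,\dots,C_p$ (genus $\ge1$) and rational components $R\cong\mathbb P^1$, one for each zero lying on the $\gamma$'s and containing exactly that marking; a figure eight surface $C_j$ is attached to one rational component at one separating node, where $\eta_{C_j}$ has order $c_j$ and $\eta_R$ has order $-c_j-2$; a pair of holes surface $C_i$ is attached to the adjacent rational components at two nodes, where $\eta_{C_i}$ has orders $a_i,b_i$ and the rational components have orders $-a_i-2,-b_i-2$; each cylinder between two consecutive blocks gives a node at which both branches (on rational components) have order $-1$ with opposite residues. At markings $\eta$ has the prescribed orders $m_j$, and there are no other zeros or poles. The dual graph has a unique cycle. Parity. For a holomorphic differential $\omega$ with $(\omega)=\sum2k_jz_j$ on a smooth curve $X$, $\phi(X,\omega)=h^0(X,\mathcal O(\sum k_jz_j))\bmod2$. If $\eta$ has even order at all nodes and markings, the limit spin structure on $(C,\eta)$ (in the sense of Cornalba) is the line bundle $\mathcal L$ on the curve $\widetilde C$ obtained by inserting an exceptional component $\cong\mathbb P^1$ at every node of $C$, with $\mathcal L$ restricting to $\mathcal O(1)$ on exceptional components and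 to $\mathcal O(\tfrac12(\eta_X))$ on every component $X$ of $C$; its parity is $\phi(C,\eta)=h^0(\widetilde C,\mathcal L)\bmod2$. (For $\mu$ with even entries, $\eta$ automatically has even order at separating nodes.) *)

(* Defs.v *)
From HB Require Import structures.
From Stdlib Require Eqdep_dec.
From mathcomp Require Import all_boot all_order all_algebra.
From mathcomp Require Import all_classical.

Set Implicit Arguments.
Unset Strict Implicit.
Unset Printing Implicit Defensive.

Import Order.TTheory GRing.Theory Num.Theory.
Local Open Scope ring_scope.
Local Open Scope classical_set_scope.

#[short(type="fieldAlgType")]
HB.structure Definition FieldAlgebra (k : nzRingType) :=
  {K of GRing.ComUnitAlgebra k K & GRing.Field K}.

Definition dprod (k : nzRingType) (I : Type) (V : I -> lmodType k) : Type :=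
  forall i, V i.

Section DProd.
Variables (k : nzRingType) (I : Type) (V : I -> lmodType k).
Implicit Types s t u : dprod V.

HB.instance Definition _ := gen_eqMixin (dprod V).
HB.instance Definition _ := gen_choiceMixin (dprod V).

Let add s t : dprod V := fun i => s i + t i.
Let opp s : dprod V := fun i => - s i.
Let scale (a : k) s : dprod V := fun i => a *: s i.

Fact dprod_addA : associative add.
Proof. by move=> s t u; apply: functional_extensionality_dep => i; exact: addrA. Qed.
Fact dprod_addC : commutative add.
Proof. by move=> s t; apply: functional_extensionality_dep => i; exact: addrC. Qed.
Fact dprod_add0 : left_id (fun i => 0 : V i) add.
Proof. by move=> s; apply: functional_extensionality_dep => i; exact: add0r. Qed.
Fact dprod_addN : left_inverse (fun i => 0 : V i) opp add.
Proof. by move=> s; apply: functional_extensionality_dep => i; exact: addNr. Qed.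

HB.instance Definition _ := GRing.isZmodule.Build (dprod V)
  dprod_addA dprod_addC dprod_add0 dprod_addN.

Fact dprod_scaleA a b s : scale a (scale b s) = scale (a * b) s.
Proof. by apply: functional_extensionality_dep => i; exact: scalerA. Qed.
Fact dprod_scale1 : left_id 1 scale.
Proof. by move=> s; apply: functional_extensionality_dep => i; exact: scale1r. Qed.
Fact dprod_scaleDr : right_distributive scale +%R.
Proof. by move=> a s t; apply: functional_extensionality_dep => i; exact: scalerDr. Qed.
Fact dprod_scaleDl s : {morph scale^~ s : a b / a + b}.
Proof. by move=> a b; apply: functional_extensionality_dep => i; exact: scalerDl. Qed.

HB.instance Definition _ := GRing.Zmodule_isLmodule.Build k (dprod V)
  dprod_scaleA dprod_scale1 dprod_scaleDr dprod_scaleDl.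
End DProd.

Definition is_basis (k : nzRingType) (V : lmodType k) (S : set V) (n : nat)
    (b : 'I_n -> V) : Prop :=
  (forall j, S (b j)) /\
  (forall s, S s -> exists! a : 'rV[k]_n, s = \sum_(j < n) a 0 j *: b j).

(* Dimension of a subspace S of V; the junk value 0 is taken when S is not
   finite-dimensional. *)
Definition dim (k : nzRingType) (V : lmodType k) (S : set V) : nat :=
  xget 0%N [set n | exists b : 'I_n -> V, is_basis S b].

(* A smooth projective connected curve over the algebraically closed field k is
   given by its field of rational functions K, an algebraic function field of
   one variable over k: a finite extension of k(t), with t transcendental. Its
   points are the discrete valuations of K trivial on k (Hartshorne, I.6). For
   k the complex numbers these are the compact Riemann surfaces. *)
Section Curves.
Variable k : closedFieldType.

Definition transcendental (K : fieldAlgType k) (t : K) : Prop :=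
  forall p : {poly k}, p != 0 -> horner_alg t p != 0.

(* x belongs to the subfield k(t) *)
Definition in_ratfun (K : fieldAlgType k) (t x : K) : Prop :=
  exists p q : {poly k},
    horner_alg t q != 0 /\ x = horner_alg t p / horner_alg t q.

Definition is_function_field (K : fieldAlgType k) : Prop :=
  exists t : K, transcendental t /\
  exists (n : nat) (b : 'I_n -> K), forall f : K,
    exists c : 'I_n -> K,
      (forall i, in_ratfun t (c i)) /\ f = \sum_(i < n) c i * b i.

Record curve := Curve {
  fun_field :> fieldAlgType k;
  curveP : is_function_field fun_field }.

Definition rational (X : curve) : Prop :=
  exists t : X, transcendental t /\ forall f : X, in_ratfun t f.

(* Normalized discrete valuations; the order of 0 is set to the junk value 0,
   so that a place is determined by its valuation. *)
Record place (X : curve) := Place {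
  ord : X -> int;
  ord0 : ord 0 = 0;
  ord_cst : forall c : k, ord c%:A = 0;
  ordM : forall f h, f != 0 -> h != 0 -> ord (f * h) = ord f + ord h;
  ordD : forall f h, f != 0 -> h != 0 -> f + h != 0 ->
    Num.min (ord f) (ord h) <= ord (f + h);
  ord_onto : exists f, ord f = 1 }.

(* A local parameter at P. *)
Definition unif (X : curve) (P : place X) : X := sval (cid (ord_onto P)).

(* The value at P of a function regular at P. *)
Definition value (X : curve) (P : place X) (f : X) : k :=
  xget 0 [set c | f = c%:A \/ 0 < ord P (f - c%:A)].

Definition is_divisor (X : curve) (D : place X -> int) : Prop :=
  finite_set [set P | D P != 0].

Definition lin_equiv (X : curve) (D E : place X -> int) : Prop :=
  exists2 h : X, h != 0 & forall P, D P = E P + ord P h.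

Definition pt_divisor (X : curve) (P : place X) : place X -> int :=
  fun Q => if `[< Q = P >] then 1 else 0.

(* Meaningful as D / 2 only when D is even. *)
Definition half (X : curve) (D : place X -> int) : place X -> int :=
  fun P => (D P %/ 2)%Z.

(* H^0(X, O(D)) *)
Definition sections (X : curve) (D : place X -> int) : set X :=
  [set f | f = 0 \/ forall P, 0 <= ord P f + D P].

Definition h0 (X : curve) (D : place X -> int) : nat := dim (sections D).

Record derivation (X : curve) := Derivation {
  der :> X -> X;
  derD : forall f h, der (f + h) = der f + der h;
  derZ : forall (c : k) f, der (c *: f) = c *: der f;
  derM : forall f h, der (f * h) = f * der h + h * der f }.

(* The K-vector space of Kaehler differentials of K/k has dimension 1, hence it
   embeds in its bidual: a differential is identified with the function on
   derivations induced by it, where dh is evaluation at h. *)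
Definition is_kahler (X : curve)
    (w : derivation X -> X) : Prop :=
  exists s : seq (X * X), forall d : derivation X,
    w d = \sum_(fh <- s) fh.1 * d fh.2.

Record differential (X : curve) := Differential {
  diff_fun :> derivation X -> X;
  diff_kahler : is_kahler diff_fun }.

(* The function f such that w = f dt, for t the local parameter at P. *)
Definition loc_coef (X : curve) (P : place X)
    (w : derivation X -> X) : X :=
  xget 0 [set f | forall d : derivation X, w d = f * d (unif P)].

Definition ord_diff (X : curve)
    (w : derivation X -> X) (P : place X) : int :=
  ord P (loc_coef P w).

(* The residue at P, provided w has at most a simple pole there. *)
Definition residue1 (X : curve)
    (w : derivation X -> X) (P : place X) : k :=
  value P (loc_coef P w * unif P).

Definition genus (X : curve) : nat :=
  dim [set w : derivation X -> X |
        is_kahler w /\ forall P, 0 <= ord_diff w P].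

Definition parity (X : curve) (w : differential X) : nat :=
  (h0 (half (ord_diff w)) %% 2)%N.

(* Multigraph with loops; every edge has two ends, indexed by bool. *)
Record graph := Graph {
  vert : finType;
  edge : finType;
  ends : edge -> bool -> vert }.

Definition adj_without (G : graph) (e : edge G) : rel (vert G) :=
  fun v w => [exists f : edge G, (f != e) &&
    [exists b : bool, (ends f b == v) && (ends f (~~ b) == w)]].

Definition separating (G : graph) (e : edge G) : bool :=
  ~~ connect (adj_without e) (ends e false) (ends e true).

(* A nodal curve with dual graph G, given by its normalization and, for each
   node e, the two points branch e false and branch e true identified at e. *)
Record nodal_curve (G : graph) := NodalCurve {
  comp :> vert G -> curve;
  branch : forall e b, place (comp (ends e b));
  branch_inj : injective (fun eb : edge G * bool =>
    existT (fun v => place (comp v)) (ends eb.1 eb.2) (branch eb.1 eb.2)) }.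

Arguments branch {G} _ e b.

(* Every line bundle is, up to isomorphism, given by line bundles O(D_v) on the
   components and, at each node, an isomorphism between the two fibres. The
   fibre of O(D) at P is identified with k by means of the generator
   t^(-D(P)), where t is the local parameter at P. *)
Record line_bundle (G : graph) (C : nodal_curve G) := LineBundle {
  restr : forall v, place (C v) -> int;
  restr_div : forall v, is_divisor (@restr v);
  glue : edge G -> k;
  glue_neq0 : forall e, glue e != 0 }.

Arguments restr {G C} _ v P.
Arguments glue {G C} _ e.

Definition fibre_value (X : curve) (D : place X -> int) (P : place X) (f : X) :
  k := value P (f * unif P ^ D P).

Definition glob_sections (G : graph) (C : nodal_curve G) (L : line_bundle C) :
    set (dprod (fun v => C v : lmodType k)) :=
  [set s | (forall v, sections (restr L v) (s v)) /\
    forall e, fibre_value (restr L _) (branch C e true) (s _) =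
      glue L e * fibre_value (restr L _) (branch C e false) (s _)].

Definition nodal_h0 (G : graph) (C : nodal_curve G) (L : line_bundle C) : nat :=
  dim (glob_sections L).

(* P^1 with two distinct points *)
Record exc_comp := ExcComp {
  exc_curve :> curve;
  exc_rational : rational exc_curve;
  exc_pt : bool -> place exc_curve;
  exc_pt_inj : injective exc_pt }.

(* The node e is replaced with the nodes (e, false) and (e, true), at which the
   new component meets the two branches of e. *)
Definition blowup_graph (G : graph) : graph :=
  @Graph (vert G + edge G)%type (edge G * bool)%type
    (fun eb c => if c then inr eb.1 else inl (ends eb.1 eb.2)).

Section Blowup.
Variables (G : graph) (C : nodal_curve G) (E : edge G -> exc_comp).

Definition blowup_comp (v : vert (blowup_graph G)) : curve :=
  match v with inl v => C v | inr e => E e end.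

Definition blowup_branch (eb : edge (blowup_graph G)) (c : bool) :
    place (blowup_comp (ends eb c)) :=
  match c return place (blowup_comp (ends eb c)) with
  | false => branch C eb.1 eb.2
  | true => exc_pt (E eb.1) eb.2
  end.

Fact blowup_branch_inj : injective (fun x : edge (blowup_graph G) * bool =>
  existT (fun v => place (blowup_comp v)) (ends x.1 x.2)
         (blowup_branch x.1 x.2)).
Proof.
pose back (z : {v & place (blowup_comp v)}) :
    ({v & place (C v)} + {e & place (E e)})%type :=
  match z with existT v P =>
    match v return place (blowup_comp v) -> _ with
    | inl v => fun P => inl (existT (fun v => place (C v)) v P)
    | inr e => fun P => inr (existT (fun e => place (E e)) e P)
    end P end.
move=> [[e b] c] [[e' b'] c'] /(congr1 back) /=.
case: c; case: c' => //=.
  case=> ee'; case: e' / ee' => h.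
  have dec (e1 e2 : edge G) : {e1 = e2} + {e1 <> e2} by exact: eq_comparable.
  by rewrite (exc_pt_inj (Eqdep_dec.inj_pair2_eq_dec _ dec _ _ _ _ h)).
by move=> h; have [-> ->] := @branch_inj G C (e, b) (e', b') (inl_inj h).
Qed.

Definition blowup : nodal_curve (blowup_graph G) :=
  NodalCurve blowup_branch_inj.
End Blowup.

(* A nodal curve with n marked points and, on each component, a differential
   which is not identically zero. *)
Record twisted_curve (G : graph) (n : nat) := TwistedCurve {
  tw_curve :> nodal_curve G;
  mark_vert : 'I_n -> vert G;
  mark : forall i, place (tw_curve (mark_vert i));
  mark_inj : injective (fun i =>
    existT (fun v => place (tw_curve v)) (mark_vert i) (mark i));
  mark_branch : forall i e b,
    existT (fun v => place (tw_curve v)) (mark_vert i) (mark i) <>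
    existT (fun v => place (tw_curve v)) (ends e b) (branch tw_curve e b);
  tw_diff : forall v, differential (tw_curve v);
  tw_diff_neq0 : forall v, exists d : derivation (tw_curve v),
    tw_diff v d != 0 }.

Arguments mark_vert {G n} _ i.
Arguments mark {G n} _ i.
Arguments tw_diff {G n} _ v.

Definition node_order (G : graph) (n : nat) (T : twisted_curve G n)
    (e : edge G) (b : bool) : int :=
  ord_diff (tw_diff T (ends e b)) (branch T e b).

Definition is_limit_spin (G : graph) (n : nat) (T : twisted_curve G n)
    (E : edge G -> exc_comp) (L : line_bundle (blowup T E)) : Prop :=
  (forall v : vert G,
    @lin_equiv (T v) (restr L (inl v)) (half (ord_diff (tw_diff T v)))) /\
  (forall e : edge G, exists P : place (E e),
    @lin_equiv (E e) (restr L (inr e)) (pt_divisor P)).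

Definition nodal_parity (G : graph) (C : nodal_curve G) (L : line_bundle C) :
  nat := (nodal_h0 L %% 2)%N.
End Curves.

(* mu is the vector of orders of zeros of a holomorphic differential in
   genus g: the orders add up to 2g - 2. *)
Definition is_signature (g n : nat) (mu : 'I_n -> nat) : Prop :=
  (forall i, 0 < mu i)%N /\ (\sum_(i < n) mu i + 2 = 2 * g)%N.

Inductive block :=
  | PairOfHoles of nat & nat     (* a_i, b_i *)
  | FigureEight of nat & nat.    (* c'_j, c''_j *)

Definition is_eight (B : block) : bool :=
  if B is FigureEight _ _ then true else false.

Definition alpha : bool := true.
Definition beta : bool := false.

(* The surfaces C_k are indexed in their cyclic order by 'I_nblock, and
   (k, alpha), (k, beta) stand for the boundary components alpha_k, beta_k.
   The index k belongs to cyl if a cylinder is inserted between alpha_k and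
   beta_(k+1), otherwise these are identified. Hence there are q = #|cyl|
   cylinders and m = nblock + q saddle connections gamma_l, and cyl amounts to
   the subset L of the m cyclically ordered pieces. The label of the zero
   lying on a boundary component is given by base. *)
Record config (n : nat) := Config {
  nblock : nat;
  blk : 'I_nblock -> block;
  cyl : {set 'I_nblock};
  base : 'I_nblock * bool -> 'I_n }.

Arguments blk {n} _ k.
Arguments cyl {n} _.
Arguments base {n} _ x.

Section Config.
Variables (n : nat) (cfg : config n).
Local Notation side := ('I_(nblock cfg) * bool)%type.

(* alpha_k is identified with beta_(k+1), or meets beta_k in a figure eight. *)
Definition same_zero : rel side := fun x y =>
  [&& x.2 == alpha, y.2 == beta &
      ((y.1 == ordS x.1) && (x.1 \notin cyl cfg)) ||
      ((y.1 == x.1) && is_eight (blk cfg x.1))].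

(* Total angle around the zero s, in units of pi; each side of a cylinder
   contributes pi. *)
Definition angle (s : 'I_n) : nat :=
  (\sum_(k < nblock cfg)
     match blk cfg k with
     | PairOfHoles a b => (base cfg (k, alpha) == s) * (2 * a + 3) +
                          (base cfg (k, beta) == s) * (2 * b + 3)
     | FigureEight c' c'' =>
         (base cfg (k, alpha) == s) * (2 * (c' + 1) + 2 * (c'' + 1))
     end +
   \sum_(k in cyl cfg)
     ((base cfg (k, alpha) == s) + (base cfg (ordS k, beta) == s)))%N.

(* The second condition says that the gamma_l are closed: if only figure eights
   are glued, and no cylinders, then the gamma_l join two distinct zeros
   (configurations of type I). *)
Definition admissible (mu : 'I_n -> nat) : Prop :=
  [/\ forall x y : side, (base cfg x == base cfg y) =
        connect (fun u v => same_zero u v || same_zero v u) x y,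
      exists k, (k \in cyl cfg) || ~~ is_eight (blk cfg k) &
      forall s, s \in codom (base cfg) -> angle s = (2 * (mu s + 1))%N].

(* A figure eight is attached at a single node, which we index by alpha. *)
Definition attaching (x : side) : bool := (x.2 == alpha) || ~~ is_eight (blk cfg x.1).

Definition gamma_zero : Type := {s : 'I_n | s \in codom (base cfg)}.
HB.instance Definition _ := Finite.on gamma_zero.

Definition zero_of (x : side) : gamma_zero :=
  exist _ (base cfg x) (codom_f (base cfg) x).

(* Vertices: inl k for C_k, inr s for the rational component through the zero
   s. Edges: inl x for attaching C_(x.1), inr k for the cylinder k. *)
Definition dual_graph : graph :=
  @Graph ('I_(nblock cfg) + gamma_zero)%type
    ({x : side | attaching x} + {k | k \in cyl cfg})%type
    (fun e b => match e with
      | inl x => if b then inr (zero_of (val x)) else inl (val x).1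
      | inr k => inr (zero_of (if b then (ordS (val k), beta)
                               else (val k, alpha)))
      end).

Definition zero_order (x : side) : nat :=
  match blk cfg x.1 with
  | PairOfHoles a b => if x.2 == alpha then a else b
  | FigureEight c' c'' => c' + c''
  end.

Definition edge_order (e : edge dual_graph) (b : bool) : int :=
  match e with
  | inl x => let c := (zero_order (val x))%:Z in if b then - c - 2 else c
  | inr _ => - 1
  end.
End Config.

(* The explicit description of the limit twisted differentials by components,
   nodes, orders and residues. Every limit of surfaces with configuration cfg
   has this form; finer constraints on the rational components (such as
   vanishing residues at the figure eight nodes) are not imposed. *)
Definition principal_boundary (k : closedFieldType) (g n : nat)
    (mu : 'I_n -> nat) (cfg : config n)
    (T : twisted_curve k (dual_graph cfg) n) : Prop :=
  [/\ [/\ forall i, (1 <= genus (T (inl i)))%N,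
          g = (1 + \sum_(i < nblock cfg) genus (T (inl i)))%N &
          forall s, rational (T (inr s))],
      forall (i : 'I_n) (s : gamma_zero cfg),
        (mark_vert T i == inr s) = (i == val s),
      [/\ forall i, ord_diff (tw_diff T _) (mark T i) = (mu i)%:Z,
          forall e b, node_order T e b = edge_order e b &
          forall v (P : place (T v)),
            (forall i, existT (fun v => place (T v)) _ (mark T i) <>
                       existT _ v P) ->
            (forall e b, existT (fun v => place (T v)) _ (branch T e b) <>
                         existT _ v P) ->
            ord_diff (tw_diff T v) P = 0] &
      forall c : {c | c \in cyl cfg}, let e : edge (dual_graph cfg) := inr c in
        residue1 (tw_diff T (ends e false)) (branch T e false) =
        - residue1 (tw_diff T (ends e true)) (branch T e true)].

(* Main.v *)
(* No section of a theta characteristic survives on a rational component, and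
   the exceptional components impose no condition, so that h^0 of the limit spin
   structure is the sum of the h^0 of the components of positive genus.
   - A section of O(1) on an exceptional component is determined by its values at
     the two nodes, which are arbitrary. Hence a global section amounts to an
     independent choice of a section on each component of C.
   - If f is a section of half the divisor of w, then f^2 w is holomorphic, and
     there is no nonzero holomorphic differential on P^1.
   - On C_i, multiplication by a fixed nonzero section of the half-canonical
     bundle embeds its sections into the holomorphic differentials. These are
     finite-dimensional as soon as the genus is positive, since dim is 0 in
     infinite dimension; so no finiteness theorem for H^0 is needed.
   Halves rounded down suffice for this argument, so the parity of the orders
   plays no role. *)
From HB Require Import structures.
From mathcomp Require Import all_boot all_order all_algebra.
From mathcomp Require Import all_classical all_reals.
From mathcomp Require Import complex.
From mathcomp Require Import ring zify.
Require Import Defs.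

Set Implicit Arguments.
Unset Strict Implicit.
Unset Printing Implicit Defensive.

Import Order.TTheory GRing.Theory Num.Theory.
Local Open Scope ring_scope.
Local Open Scope classical_set_scope.

(** * Algebraic elements over the subfield k(t) *)

Section Algebraic.
Variables (K : fieldType) (S : divringClosed K).

Definition subfield := {x : K | x \in S}.
HB.instance Definition _ := SubType.on subfield.
HB.instance Definition _ := Choice.on subfield.
HB.instance Definition _ := [SubChoice_isSubComUnitRing of subfield by <:].
HB.instance Definition _ := [SubComUnitRing_isSubIntegralDomain of subfield by <:].
HB.instance Definition _ := [SubIntegralDomain_isSubField of subfield by <:].

Definition algebraic (x : K) :=
  exists2 p : {poly K}, p != 0 & p \is a polyOver S /\ root p x.

Let inj : {rmorphism subfield -> K} := val.

(** Coefficients are moved between [K] and the field [subfield]; closure of algebraic elements under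
    sums, products and inverses is then inherited from integral elements. *)
Lemma algebraic_integral x : algebraic x <-> integralOver inj x.
Proof.
rewrite -integral_algebraic; split=> [[p p0 [/polyOverP pS px]]|[p p0 px]].
  pose q := \poly_(i < size p) (Sub p`_i (pS i) : subfield).
  have pq : map_poly inj q = p.
    apply/polyP => i; rewrite coef_map coef_poly; case: ltnP => // ip.
    by rewrite raddf0 nth_default.
  by exists q; [rewrite -(map_poly_eq0 inj) pq|rewrite pq].
exists (map_poly inj p); first by rewrite map_poly_eq0.
by split=> //; apply/polyOverP => i; rewrite coef_map; exact: valP.
Qed.

Lemma algebraic_id x : x \in S -> algebraic x.
Proof.
move=> xS; exists ('X - x%:P); first by rewrite polyXsubC_eq0.
by rewrite polyOverXsubC root_XsubC.
Qed.

Lemma algebraicD x y : algebraic x -> algebraic y -> algebraic (x + y).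
Proof. by rewrite !algebraic_integral; exact: integral_add. Qed.

Lemma algebraicM x y : algebraic x -> algebraic y -> algebraic (x * y).
Proof. by rewrite !algebraic_integral; exact: integral_mul. Qed.

Lemma algebraicV x : algebraic x -> algebraic x^-1.
Proof. by rewrite !algebraic_integral; exact: integral_inv. Qed.

Lemma algebraic_root (p : {poly K}) x :
  p != 0 -> (forall i, algebraic p`_i) -> root p x -> algebraic x.
Proof.
move=> p0 pS px; rewrite algebraic_integral; apply: integral_root p0 px _.
by move=> y /(nthP 0)[i _ <-]; rewrite -algebraic_integral.
Qed.

End Algebraic.

(** * Elements of a finite extension *)

Section FiniteExtension.
Variables (K : fieldType) (S : subringClosed K).

Lemma char_poly_polyOver n (A : 'M[K]_n) :
  (forall i j, A i j \in S) -> char_poly A \is a polyOver S.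
Proof.
move=> AS; apply: rpred_sum => s _; apply: rpredM.
  by rewrite rpredX // rpredN rpred1.
apply: rpred_prod => i _; rewrite !mxE; apply: rpredB; last by rewrite polyOverC.
by rewrite rpredMn // polyOverX.
Qed.

(** Multiplication by [x] acts on the spanning family [b] through a matrix over [S]. The row of the
    [b i] is an eigenvector for [x], so [x] is a root of the characteristic polynomial. *)
Lemma finite_algebraic n (b : 'I_n -> K) :
  (forall x : K, exists c : 'I_n -> K,
     (forall i, c i \in S) /\ x = \sum_(i < n) c i * b i) ->
  forall x, exists2 p : {poly K}, p \is monic & p \is a polyOver S /\ root p x.
Proof.
move=> bP x.
have [c cP] := choice (fun i => bP (x * b i)).
pose A := \matrix_(i, j) c j i.
exists (char_poly A); first exact: char_poly_monic.
split; first by apply: char_poly_polyOver => i j; rewrite mxE; apply: (cP j).1.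
rewrite -eigenvalue_root_char; apply/eigenvalueP.
exists (\row_i b i).
  apply/rowP => i; rewrite !mxE (cP i).2; apply: eq_bigr => j _.
  by rewrite !mxE mulrC.
(* An eigenvector must be nonzero: [1] is a combination of the [b i]. *)
apply/eqP => b0; have [d [_ d1]] := bP 1.
suff : (1 : K) = 0 by apply/eqP; exact: oner_neq0.
rewrite d1 big1 // => i _.
by have /rowP/(_ i) := b0; rewrite !mxE => ->; rewrite mulr0.
Qed.

End FiniteExtension.

(** * Rational functions of one element and transcendence degree one *)

Section Ratfun.
Variables (k : closedFieldType) (K : fieldAlgType k).
Implicit Types t x : K.

Definition ratfun t : {pred K} := [pred x | `[< in_ratfun t x >]].

Lemma ratfunP t x : reflect (in_ratfun t x) (x \in ratfun t).
Proof. exact: asboolP. Qed.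

Lemma ratfun_divring t : divring_closed (ratfun t).
Proof.
split.
- by apply/ratfunP; exists 1, 1; rewrite rmorph1 oner_neq0 divr1.
- move=> _ _ /ratfunP[p [q [q0 ->]]] /ratfunP[p' [q' [q0' ->]]].
  apply/ratfunP; exists (p * q' - p' * q), (q * q').
  rewrite rmorphB !rmorphM mulf_neq0 //; split=> //=.
  field; do ?[apply/andP; split]; assumption.
- move=> _ _ /ratfunP[p [q [q0 ->]]] /ratfunP[p' [q' [q0' ->]]].
  apply/ratfunP; have [p0|p0] := eqVneq (horner_alg t p') 0.
    by exists 0, 1; rewrite p0 mul0r invr0 mulr0 rmorph0 mul0r rmorph1 oner_neq0.
  exists (p * q'), (q * p'); rewrite !rmorphM mulf_neq0 //; split=> //=.
  field; do ?[apply/andP; split]; assumption.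
Qed.

HB.instance Definition _ t :=
  GRing.isDivringClosed.Build K (ratfun t) (ratfun_divring t).

Lemma ratfun_poly t (p : {poly k}) : horner_alg t p \in ratfun t.
Proof. by apply/ratfunP; exists p, 1; rewrite rmorph1 oner_neq0 divr1. Qed.

Lemma ratfun_gen t : t \in ratfun t.
Proof. by rewrite -[X in X \in _]horner_algX ratfun_poly. Qed.

Lemma ratfun_cst t (c : k) : c%:A \in ratfun t.
Proof. by rewrite -(horner_algC t) ratfun_poly. Qed.

Lemma ratfun_min (S : divringClosed K) t :
  (forall c : k, c%:A \in S) -> t \in S -> {subset ratfun t <= S}.
Proof.
move=> kS tS _ /ratfunP[p [q [_ ->]]].
suff pS (r : {poly k}) : horner_alg t r \in S by rewrite rpred_div.
elim/poly_ind: r => [|r c IH]; first by rewrite rmorph0 rpred0.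
by rewrite rmorphD rmorphM /= horner_algC horner_algX rpredD ?rpredM.
Qed.

Lemma common_denominator t n (c : nat -> K) : (forall i, c i \in ratfun t) ->
  exists (q : {poly k}) (p : nat -> {poly k}), horner_alg t q != 0 /\
    forall i, (i < n)%N -> c i = horner_alg t (p i) / horner_alg t q.
Proof.
move=> ct; elim: n => [|n [q [p [q0 pP]]]].
  by exists 1, (fun _ => 0); rewrite rmorph1 oner_neq0.
have /ratfunP[p' [q' [q0' cn]]] := ct n.
exists (q * q'), (fun i => if (i < n)%N then p i * q' else p' * q).
split; first by rewrite rmorphM mulf_neq0.
move=> i; rewrite ltnS leq_eqVlt => /predU1P[->|lt_in].
  by rewrite ltnn cn !rmorphM /=; field; rewrite q0 q0'.
by rewrite lt_in pP // !rmorphM /=; field; rewrite q0 q0'.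
Qed.

(** Polynomials split over the algebraically closed [k], so a polynomial relation for [t] makes some
    [t - c] vanish. *)
Lemma transcendentalP t :
  transcendental t <-> forall c : k, t != c%:A.
Proof.
split=> [tt c|tt p p0].
  have := tt ('X - c%:P) (negbT (polyXsubC_eq0 c)).
  by rewrite rmorphB /= horner_algX horner_algC subr_eq0.
have [s ->] := closed_field_poly_normal p.
rewrite linearZ /= mulf_neq0 //.
  by rewrite scaler_eq0 negb_or lead_coef_eq0 p0 oner_neq0.
rewrite rmorph_prod /=.
rewrite prodf_seq_neq0; apply/allP => c _ /=.
by rewrite rmorphB /= horner_algX horner_algC subr_eq0.
Qed.

(* Read the relation satisfied by u over k(t), cleared of denominators, as a
   polynomial in t over k(u). *)
Lemma exchange t u :
  transcendental u -> algebraic (ratfun t) u -> algebraic (ratfun u) t.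
Proof.
move=> ut [P P0 [/polyOverP PS Pu]].
have [q [p [q0 pP]]] := common_denominator (size P) PS.
pose m := size P.
(* [c j] is the coefficient of [t^j] in the cleared relation, as a polynomial in [u]. *)
pose c j := \poly_(i < m) (p i)`_j.
pose G : {poly K} := \sum_(i < m) u ^+ i *: map_poly (in_alg K) (p i).
have GE j : G`_j = horner_alg u (c j).
  rewrite coef_sum [c j]poly_def raddf_sum /=; apply: eq_bigr => i _.
  by rewrite coefZ coef_map linearZ rmorphXn /= horner_algX mulr_algl mulr_algr.
have m0 : (0 < m)%N by rewrite lt0n size_poly_eq0.
have lt_m : (m.-1 < m)%N by rewrite prednK.
exists G.
  (* [G] is nonzero: the leading coefficient of [P] gives [p m.-1 != 0], and at the degree of
     [p m.-1] the coefficient of [G] is a nonzero polynomial in the transcendental [u]. *)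
  have : P`_m.-1 != 0 by rewrite -lead_coefE lead_coef_eq0.
  rewrite pP // => pm0.
  have {}pm0 : p m.-1 != 0.
    by apply: contraNneq pm0 => ->; rewrite rmorph0 mul0r.
  have /ut : c (size (p m.-1)).-1 != 0.
    apply/eqP => /polyP/(_ m.-1); rewrite coef_poly lt_m coef0 => /eqP.
    by rewrite -lead_coefE lead_coef_eq0 (negPf pm0).
  by rewrite -GE; apply: contraNneq => ->; rewrite coef0.
split; first by apply/polyOverP => j; rewrite GE ratfun_poly.
apply/rootP; rewrite horner_sum.
(* Evaluated at [t], [G] is the relation [P.[u] = 0] multiplied by the common denominator. *)
transitivity (horner_alg t q * P.[u]); last by rewrite (rootP Pu) mulr0.
rewrite horner_coef mulr_sumr; apply: eq_bigr => i _.
rewrite hornerZ pP //= mulrA mulrC; congr (_ * _).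
by rewrite mulrCA mulfV // mulr1.
Qed.

(** By [exchange] the element [t] of the definition is algebraic over k(u), hence so is everything
    algebraic over k(t). *)
Lemma algebraic_ratfun u x :
  is_function_field K -> transcendental u -> algebraic (ratfun u) x.
Proof.
move=> [t [tt [n [b bP]]]] ut.
have fin y : exists2 p : {poly K}, p \is monic &
    p \is a polyOver (ratfun t) /\ root p y.
  apply: (finite_algebraic (b := b)) => f; have [c [cP ->]] := bP f.
  by exists c; split=> // i; apply/ratfunP.
have algt : algebraic (ratfun u) t.
  by apply: exchange ut _; have [p /monic_neq0 p0 H] := fin u; exists p.
have [p /monic_neq0 p0 [/polyOverP pS px]] := fin x.
apply: algebraic_root p0 _ px => i.
have /ratfunP[r [s [_ ->]]] := pS i.
have alg_poly (q : {poly k}) : algebraic (ratfun u) (horner_alg t q).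
  elim/poly_ind: q => [|q c IH].
    by rewrite rmorph0; apply: algebraic_id; rewrite rpred0.
  rewrite rmorphD rmorphM /= horner_algC horner_algX.
  apply: algebraicD; first exact: algebraicM.
  by apply: algebraic_id; rewrite ratfun_cst.
exact: algebraicM (alg_poly r) (algebraicV (alg_poly s)).
Qed.

End Ratfun.

(** * Places and residue fields *)

Section Places.
Variables (k : closedFieldType) (X : curve k) (P : place X).
Implicit Types (f h : X) (m : int).

Lemma ord1 : ord P 1 = 0.
Proof. by rewrite -(scale1r (1 : X)) ord_cst. Qed.

Lemma ordV f : ord P f^-1 = - ord P f.
Proof.
have [->|f0] := eqVneq f 0; first by rewrite invr0 ord0 oppr0.
have := ordM P f0 (_ : f^-1 != 0); rewrite invr_eq0 => /(_ f0).
by rewrite mulfV // ord1 => /esym/eqP; rewrite addrC addr_eq0 => /eqP.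
Qed.

Lemma ordX f n : f != 0 -> ord P (f ^+ n) = ord P f *+ n.
Proof.
move=> f0; elim: n => [|n IH]; first by rewrite ord1.
by rewrite exprS ordM ?expf_neq0 // IH mulrS.
Qed.

Lemma ordZ (c : k) f : c != 0 -> ord P (c *: f) = ord P f.
Proof.
move=> c0; have [->|f0] := eqVneq f 0; first by rewrite scaler0.
by rewrite -mulr_algl ordM ?ord_cst ?add0r // scaler_eq0 negb_or c0 oner_neq0.
Qed.

Lemma ordN f : ord P (- f) = ord P f.
Proof. by rewrite -scaleN1r ordZ // oppr_eq0 oner_neq0. Qed.

(* As ord P 0 is the junk value 0, the zero function is treated apart: it
   vanishes to every order. *)
Definition vge m f := f = 0 \/ m <= ord P f.

Lemma vgeE m f : f != 0 -> vge m f -> m <= ord P f.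
Proof. by move=> f0 [f00|//]; rewrite f00 eqxx in f0. Qed.

Lemma vgeD m f h : vge m f -> vge m h -> vge m (f + h).
Proof.
have [->|f0] := eqVneq f 0; first by rewrite add0r.
have [->|h0] := eqVneq h 0; first by rewrite addr0.
have [->|fh0] := eqVneq (f + h) 0; first by left.
move=> /(vgeE f0) mf /(vgeE h0) mh; right; apply: le_trans (ordD P f0 h0 fh0).
by rewrite le_min mf.
Qed.

Lemma vgeZ m c f : vge m f -> vge m (c *: f).
Proof.
move=> [->|mf]; first by rewrite scaler0; left.
by have [->|c0] := eqVneq c 0; [rewrite scale0r; left|right; rewrite ordZ].
Qed.

Lemma vgeN m f : vge m f -> vge m (- f).
Proof. by rewrite -scaleN1r; exact: vgeZ. Qed.

Lemma vgeB m f h : vge m f -> vge m h -> vge m (f - h).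
Proof. by move=> mf mh; apply: vgeD mf (vgeN mh). Qed.

Lemma vgeM m n f h : vge m f -> vge n h -> vge (m + n) (f * h).
Proof.
have [->|f0] := eqVneq f 0; first by rewrite mul0r; left.
have [->|h0] := eqVneq h 0; first by rewrite mulr0; left.
by move=> /(vgeE f0) mf /(vgeE h0) nh; right; rewrite ordM // lerD.
Qed.

Lemma vgeW m n f : n <= m -> vge m f -> vge n f.
Proof. by move=> nm [->|mf]; [left|right; apply: le_trans mf]. Qed.

Lemma vge_cst (c : k) : vge 0 c%:A.
Proof. by right; rewrite ord_cst. Qed.

(** Otherwise [f = (f + h) - h] would have order greater than its own. *)
Lemma ordDl f h : f != 0 -> vge (ord P f + 1) h ->
  f + h != 0 /\ ord P (f + h) = ord P f.
Proof.
move=> f0 fh.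
have fh0 : f + h != 0.
  rewrite addr_eq0; apply: contraNneq f0 => fNh.
  by case: fh => [h0|]; [rewrite fNh h0 oppr0|rewrite fNh ordN; lia].
split=> //; apply/eqP; rewrite eq_le; apply/andP; split; last first.
  by apply: (vgeE fh0); apply: vgeD; [right|apply: vgeW fh; lia].
rewrite leNgt; apply/negP => lt_f.
have : vge (ord P f + 1) ((f + h) - h) by apply: vgeB => //; right; lia.
by rewrite addrK => /(vgeE f0); lia.
Qed.

Lemma ord_transcendental f : ord P f != 0 -> transcendental f.
Proof.
move=> f0; apply/transcendentalP => c; apply: contraNneq f0 => ->.
by rewrite ord_cst.
Qed.

Lemma ord_unif : ord P (unif P) = 1.
Proof. exact: svalP (cid (ord_onto P)). Qed.

Lemma unif_neq0 : unif P != 0.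
Proof. by apply/eqP => u0; have := ord_unif; rewrite u0 ord0. Qed.

Lemma unif_transcendental : transcendental (unif P).
Proof. by apply: ord_transcendental; rewrite ord_unif. Qed.

Lemma ordXz f m : f != 0 -> ord P (f ^ m) = ord P f * m.
Proof.
move=> f0; case: m => n; first by rewrite ordX // -mulr_natr natz.
by rewrite -[f ^ _]/(f ^- n.+1) ordV ordX // NegzE -mulr_natr mulrN natz.
Qed.

(** A nonzero constant term is a unit and dominates the rest, which is a multiple of the local
    parameter. The bound on the order serves the induction. *)
Lemma horner_unif_neq0 (p : {poly X}) :
  (forall i, p`_i != 0 -> ord P p`_i = 0) -> p != 0 ->
  p.[unif P] != 0 /\ 0 <= ord P p.[unif P].
Proof.
elim/poly_ind: p => [|p c IH] pP; first by rewrite eqxx.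
have [p0|p0 _] := eqVneq p 0.
  rewrite p0 mul0r add0r polyC_eq0 hornerC => c0; split=> //.
  by have := pP 0%N; rewrite coefD coefC coefMX eqxx add0r => ->.
have [i pi|pu0 pu] := IH _ p0.
  by have := pP i.+1; rewrite coefD coefC coefMX /= addr0; apply.
have u1 : vge 1 (p.[unif P] * unif P).
  by right; rewrite ordM ?unif_neq0 // ord_unif; lia.
rewrite hornerMXaddC; have [->|c0] := eqVneq c 0.
  by rewrite addr0 mulf_neq0 ?unif_neq0 //; case: u1 => [->|]; rewrite ?ord0; lia.
have cP : ord P c = 0.
  by have := pP 0%N; rewrite coefD coefC coefMX eqxx add0r; apply.
have [|sum0 sumE] := @ordDl c (p.[unif P] * unif P) c0; first by rewrite cP.
by rewrite addrC sumE cP.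
Qed.

(* The residue field is algebraic over k: if all the f - c were units at P, then
   so would be all of k(f)^*, over which the local parameter is algebraic. *)
Lemma residue_exists f : vge 0 f -> exists c : k, vge 1 (f - c%:A).
Proof.
move=> f0; apply: contrapT => /forallNP noc.
have fc0 c : f - c%:A != 0 by apply/eqP => fc; apply: (noc c); left.
have ft : transcendental f.
  by apply/transcendentalP => c; rewrite -subr_eq0.
have ord_fc c : ord P (f - c%:A) = 0.
  have := vgeE (fc0 c) (vgeB f0 (vge_cst c)).
  have : ~ 1 <= ord P (f - c%:A) by move=> h; apply: (noc c); right.
  by lia.
have ord_poly (p : {poly k}) : p != 0 -> ord P (horner_alg f p) = 0.
  have [s ->] := closed_field_poly_normal p.
  rewrite scaler_eq0 negb_or => /andP[lc0 _].
  rewrite linearZ /= mulr_algl ordZ // rmorph_prod /=.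
  elim: s => [|c s IH]; first by rewrite big_nil ord1.
  rewrite big_cons rmorphB /= horner_algX horner_algC ordM // ?IH ?ord_fc //.
  rewrite prodf_seq_neq0; apply/allP => z _ /=.
  by rewrite rmorphB /= horner_algX horner_algC.
have [p p0 [/polyOverP pS /rootP pu]] :=
  algebraic_ratfun (unif P) (curveP X) ft.
have [i pi|pu0 _] := @horner_unif_neq0 p _ p0; last by rewrite pu eqxx in pu0.
have /ratfunP[r [s [s0 pE]]] := pS i.
have r0 : horner_alg f r != 0.
  by apply: contraNneq pi => r0; rewrite pE r0 mul0r.
rewrite pE ordM ?invr_eq0 // ordV !ord_poly //.
  by apply: contraNneq s0 => ->; rewrite rmorph0.
by apply: contraNneq r0 => ->; rewrite rmorph0.
Qed.

(** Two such constants would differ by a constant of positive order, so the choice made in [value]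
    is forced. *)
Lemma value_eq f c : vge 1 (f - c%:A) -> value P f = c.
Proof.
rewrite /value; case: xgetP => [c' _ /= c'P cP|/(_ c) cN cP]; last first.
  exfalso; apply: cN => /=.
  by case: cP => [/eqP|]; rewrite ?subr_eq0; [move/eqP; left|right].
have {}c'P : vge 1 (f - c'%:A).
  by case: c'P => [->|]; [left; rewrite subrr|right].
apply/eqP; rewrite -subr_eq0; apply: contraT => cc0.
have : vge 1 ((c' - c)%:A : X).
  have -> : (c' - c)%:A = (f - c%:A) - (f - c'%:A) :> X.
    by rewrite scalerBl; ring.
  exact: vgeB.
by move/(vgeE _); rewrite ord_cst scaler_eq0 negb_or cc0 oner_neq0 => /(_ isT).
Qed.

Lemma valueP f : vge 0 f -> vge 1 (f - (value P f)%:A).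
Proof. by move=> /residue_exists[c cP]; rewrite (value_eq cP). Qed.

Lemma value_linear c f h : vge 0 f -> vge 0 h ->
  value P (c *: f + h) = c * value P f + value P h.
Proof.
move=> /valueP fP /valueP hP; apply: value_eq.
have -> : c *: f + h - (c * value P f + value P h)%:A =
          c *: (f - (value P f)%:A) + (h - (value P h)%:A).
  rewrite scalerDl scalerBr scalerA opprD !addrA; congr (_ - _).
  by rewrite -!addrA; congr (_ + _); rewrite addrC.
exact: vgeD (vgeZ _ fP) hP.
Qed.

Lemma value_eq0 f : vge 0 f -> value P f = 0 <-> vge 1 f.
Proof.
move=> fP; split=> [f0|f1]; last by apply: value_eq; rewrite scale0r subr0.
by have := valueP fP; rewrite f0 scale0r subr0.
Qed.

End Places.

(** * Derivations and differentials *)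

Section Derivations.
Variables (k : closedFieldType) (X : curve k).
Hypothesis pchar_k : [pchar k] =i pred0.
Implicit Types (d : derivation X) (f h u x : X).

Lemma der0 d : d 0 = 0.
Proof. by rewrite -(scale0r (0 : X)) derZ !scale0r. Qed.

Lemma derN d f : d (- f) = - d f.
Proof. by rewrite -scaleN1r derZ scaleN1r. Qed.

Lemma der_cst d (c : k) : d c%:A = 0.
Proof.
have d1 : d 1 = 0.
  by have := derM d 1 1; rewrite !mul1r -{1}[d 1]addr0 => /addrI/esym.
by rewrite derZ d1 scaler0.
Qed.

Lemma der1 d : d 1 = 0.
Proof. by rewrite -(scale1r (1 : X)) der_cst. Qed.

Lemma derV d f : f != 0 -> d f^-1 = - d f / f ^+ 2.
Proof.
move=> f0; have := derM d f f^-1; rewrite mulfV // der1 => /esym/eqP.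
rewrite addr_eq0 => /eqP /(congr1 (fun x => f^-1 * x)).
by rewrite mulKf // => ->; field.
Qed.

Definition der_ker d : {pred X} := [pred x | d x == 0].

Lemma der_ker_divring d : divring_closed (der_ker d).
Proof.
split=> [|f h|f h]; rewrite !inE ?der1 ?eqxx //= => /eqP df /eqP dh.
  by rewrite derD derN df dh subrr.
have [->|h0] := eqVneq h 0; first by rewrite invr0 mulr0 der0.
by rewrite derM derV // df dh oppr0 mul0r !mulr0 addr0.
Qed.

HB.instance Definition _ d :=
  GRing.isDivringClosed.Build X (der_ker d) (der_ker_divring d).

Lemma der_horner d (p : {poly X}) x :
  p \is a polyOver (der_ker d) -> d p.[x] = p^`().[x] * d x.
Proof.
elim/poly_ind: p => [|p c IH] /polyOverP pd.
  by rewrite deriv0 !horner0 der0 mul0r.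
have dc : d c = 0.
  by have := pd 0%N; rewrite coefD coefC coefMX eqxx add0r => /eqP.
have {}IH : d p.[x] = p^`().[x] * d x.
  apply: IH; apply/polyOverP => i; have := pd i.+1.
  by rewrite coefD coefC coefMX /= addr0.
rewrite derivMXaddC !hornerE derD derM dc IH.
by rewrite /=; ring.
Qed.

(** Descent on the degree of a relation [p]: either [p'(x)] is nonzero and [p'(x) dx = 0] forces
    [dx = 0], or [p'] is a shorter relation, nonzero in characteristic 0. *)
Lemma der_algebraic d x : algebraic (der_ker d) x -> d x = 0.
Proof.
case=> p; move: {2}(size p) (leqnn (size p)) => n.
elim: n p => [|n IH] p; first by rewrite size_poly_leq0 => /eqP ->; rewrite eqxx.
move=> le_p p0 [pd px].
have [p'x|p'x] := eqVneq p^`().[x] 0; last first.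
  have := der_horner x pd; rewrite (rootP px) der0 => /esym/eqP.
  by rewrite mulf_eq0 (negPf p'x) => /eqP.
apply: (IH p^`()).
- by rewrite -ltnS (leq_trans (lt_size_deriv p0)).
- have [s sE] : exists s, size p = s.+2.
    have := root_size_gt1 p0 px; case: (size p) => [|[|s]] // _; by exists s.
  apply/eqP => /polyP/(_ s); rewrite coef_deriv coef0 => /eqP.
  rewrite -mulr_natl mulf_eq0 -[p`_s.+1]/(p`_s.+2.-1) -sE -lead_coefE.
  rewrite lead_coef_eq0 (negPf p0) orbF.
  have /pcharf0P -> // : [pchar X] =i pred0 by move=> i; rewrite pchar_lalg pchar_k.
- split; first exact: polyOver_deriv.
  exact/rootP.
Qed.

(** The kernel of [d] is a field containing k(u), over which every element is algebraic. *)
Lemma der_eq0 d u : transcendental u -> d u = 0 -> forall x, d x = 0.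
Proof.
move=> ut du x; apply: der_algebraic.
have [p p0 [pu px]] := algebraic_ratfun x (curveP X) ut.
exists p => //; split=> //; apply: polyOverS pu.
apply: ratfun_min => [c|]; last exact/eqP.
by apply/eqP; exact: der_cst.
Qed.

Lemma der_neq0 d u : transcendental u -> (exists x, d x != 0) -> d u != 0.
Proof. by move=> ut [x]; apply: contraNneq => /(der_eq0 ut) ->. Qed.

(** The derivations form a line over the function field: [d' - c d] is a derivation that vanishes at
    [u]. *)
Lemma der_proportional (d d' : derivation X) u : transcendental u -> d u != 0 ->
  forall x, d' x = d' u / d u * d x.
Proof.
move=> ut du; pose c := d' u / d u.
pose e x := d' x - c * d x.
have eD x y : e (x + y) = e x + e y by rewrite /e !derD; ring.
have eZ (a : k) x : e (a *: x) = a *: e x.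
  by rewrite /e !derZ scalerBr scalerAr.
have eM x y : e (x * y) = x * e y + y * e x by rewrite /e !derM; ring.
have e0 x : e x = 0.
  apply: (der_eq0 (d := Derivation eD eZ eM) ut) => /=.
  by rewrite /e /c divfK ?subrr.
by move=> x; apply/eqP; rewrite -subr_eq0; apply/eqP/e0.
Qed.

Lemma kahler_linear (w : derivation X -> X) (d d' : derivation X) c :
  is_kahler w -> (forall x, d' x = c * d x) -> w d' = c * w d.
Proof.
move=> [s sE] dd'; rewrite !sE mulr_sumr; apply: eq_bigr => x _.
by rewrite dd'; ring.
Qed.

Lemma kahlerZ (w : derivation X -> X) h :
  is_kahler w -> is_kahler (fun d => h * w d).
Proof.
move=> [s sE]; exists [seq (h * fh.1, fh.2) | fh <- s] => d.
by rewrite sE mulr_sumr big_map; apply: eq_bigr => x _; rewrite mulrA.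
Qed.

Lemma kahler_supp (w : derivation X -> X) d :
  is_kahler w -> w d != 0 -> exists x, d x != 0.
Proof.
move=> [s sE]; apply: contraPP => /forallNP d0; apply/negP; rewrite negbK sE.
by rewrite big1 // => x _; have /negP := d0 x.2; rewrite negbK => /eqP ->; rewrite mulr0.
Qed.

(** Since derivations are proportional, a single nonzero one determines the local coefficient. *)
Lemma loc_coefE (P : place X) (w : derivation X -> X) d :
  is_kahler w -> (exists x, d x != 0) -> loc_coef P w = w d / d (unif P).
Proof.
move=> wk dn0.
have du := der_neq0 (unif_transcendental P) dn0.
rewrite /loc_coef; case: xgetP => [f _ /= ->|/(_ (w d / d (unif P))) []].
  by rewrite mulfK.
move=> d' /=; rewrite (kahler_linear wk (der_proportional d' (unif_transcendental P) du)).
by field.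
Qed.

(** Measures [w] against one differential [du] at all places, so that holomorphy of [w] becomes a
    condition on the single function [w d / d u]. *)
Lemma ord_diffE (P : place X) (w : derivation X -> X) d u :
    is_kahler w -> transcendental u -> w d != 0 ->
  ord_diff w P = ord P (w d / d u) - ord P (d (unif P) / d u).
Proof.
move=> wk ut wd; have dn0 := kahler_supp wk wd.
have du := der_neq0 ut dn0.
have dP := der_neq0 (unif_transcendental P) dn0.
rewrite /ord_diff (loc_coefE P wk dn0) !ordM ?invr_eq0 // !ordV; lia.
Qed.

Lemma ord_diffM (P : place X) (w : derivation X -> X) d h :
  is_kahler w -> w d != 0 -> h != 0 ->
  ord_diff (fun d => h * w d) P = ord P h + ord_diff w P.
Proof.
move=> wk wd h0; have dn0 := kahler_supp wk wd.
have dP := der_neq0 (unif_transcendental P) dn0.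
rewrite /ord_diff !(loc_coefE P _ dn0) //; last exact: kahlerZ.
by rewrite -mulrA (ordM _ h0) // mulf_neq0 // invr_eq0.
Qed.

Lemma ord_diff0 (P : place X) d :
  (exists x, d x != 0) -> ord_diff (fun _ => 0) P = 0.
Proof.
move=> dn0; rewrite /ord_diff (loc_coefE P _ dn0) ?mul0r ?ord0 //.
by exists [::] => d'; rewrite big_nil.
Qed.

(** With [m] the order of [w] at [P], each factor has order at least [- (m %/ 2)], and twice
    [m %/ 2] is at most [m]. *)
Lemma half_sections_mul (w : derivation X -> X) d f h :
  is_kahler w -> w d != 0 ->
  sections (half (ord_diff w)) f -> sections (half (ord_diff w)) h ->
  forall P, 0 <= ord_diff (fun d => f * h * w d) P.
Proof.
move=> wk wd fw hw P.
(* The zero differential gets the default order 0. *)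
have [fh0|] := eqVneq (f * h) 0.
  have -> : (fun d => f * h * w d) = fun=> 0.
    by apply: functional_extensionality_dep => d'; rewrite fh0 mul0r.
  by rewrite (ord_diff0 P (kahler_supp wk wd)).
rewrite mulf_eq0 negb_or => /andP[f0 h0].
rewrite (ord_diffM P wk wd) ?mulf_neq0 // ordM //.
case: fw => [/eqP|/(_ P)]; first by rewrite (negPf f0).
case: hw => [/eqP|/(_ P)]; first by rewrite (negPf h0).
by rewrite /half; lia.
Qed.

End Derivations.

(** * Rational curves *)

Section RationalCurves.
Variables (k : closedFieldType) (X : curve k).
Implicit Types (f g h t u : X) (p q : {poly k}) (Q : place X).

Definition generates t := transcendental t /\ forall f, in_ratfun t f.

Lemma generatesB t (c : k) : generates t -> generates (t - c%:A).
Proof.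
move=> [/transcendentalP tt tg]; split.
  apply/transcendentalP => a; rewrite subr_eq -scalerDl; exact: tt.
move=> f; apply/ratfunP; apply: (ratfun_min _ _ (introT (ratfunP t f) (tg f))).
  exact: ratfun_cst.
by rewrite -[X in X \in _](subrK c%:A) rpredD ?ratfun_cst ?ratfun_gen.
Qed.

Lemma generatesV t : generates t -> generates t^-1.
Proof.
move=> [/transcendentalP tt tg]; split.
  apply/transcendentalP => a; rewrite (can2_eq (@invrK _) (@invrK _)).
  by have := tt a^-1; rewrite -(fmorphV (in_alg X)).
move=> f; apply/ratfunP; apply: (ratfun_min _ _ (introT (ratfunP t f) (tg f))).
  exact: ratfun_cst.
by rewrite -[X in X \in _]invrK rpredV ratfun_gen.
Qed.

Lemma in_ratfun_coprime t f : in_ratfun t f -> exists p q,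
  [/\ coprimep p q, horner_alg t q != 0 & f = horner_alg t p / horner_alg t q].
Proof.
move=> [p [q [q0 ->]]]; pose d := gcdp p q.
have qn0 : q != 0 by apply: contraNneq q0 => ->; rewrite rmorph0.
have qE : horner_alg t q = horner_alg t (q %/ d) * horner_alg t d.
  by rewrite -rmorphM divpK // dvdp_gcdr.
have pE : horner_alg t p = horner_alg t (p %/ d) * horner_alg t d.
  by rewrite -rmorphM divpK // dvdp_gcdl.
move: q0; rewrite qE mulf_eq0 negb_or => /andP[q0 d0].
exists (p %/ d), (q %/ d); split=> //.
  by apply: coprimep_div_gcd; rewrite qn0 orbT.
by rewrite pE; field; apply/andP; split.
Qed.

Lemma horner_alg_neq0 t p : horner_alg t p != 0 -> p != 0.
Proof. by apply: contraNneq => ->; rewrite rmorph0. Qed.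

Lemma vge_horner Q t p : vge Q 0 t -> vge Q 0 (horner_alg t p).
Proof.
move=> t0; elim/poly_ind: p => [|p c IH]; first by rewrite rmorph0; left.
rewrite rmorphD rmorphM /= horner_algC horner_algX.
by apply: vgeD (vge_cst Q c); rewrite -(addr0 0); apply: vgeM.
Qed.

Lemma ord_horner_prod Q t p : transcendental t -> p != 0 ->
  exists2 s : seq k, p = lead_coef p *: \prod_(z <- s) ('X - z%:P) &
    ord Q (horner_alg t p) = \sum_(z <- s) ord Q (t - z%:A).
Proof.
move=> /transcendentalP tt p0; have [s pE] := closed_field_poly_normal p.
exists s => //; rewrite {1}pE.
rewrite linearZ /= mulr_algl ordZ ?lead_coef_eq0 // rmorph_prod /=.
elim: s {pE} => [|c s IH]; first by rewrite !big_nil ord1.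
rewrite !big_cons rmorphB /= horner_algX horner_algC ordM ?subr_eq0 // ?IH //.
rewrite prodf_seq_neq0; apply/allP => z _ /=.
by rewrite rmorphB /= horner_algX horner_algC subr_eq0.
Qed.

(** Where [t - c] vanishes, every other factor [t - z = (c - z) + (t - c)] is a unit. *)
Lemma ord_horner Q t c p : transcendental t -> 0 < ord Q (t - c%:A) -> p != 0 ->
  ord Q (horner_alg t p) = (mup c p)%:Z * ord Q (t - c%:A).
Proof.
move=> tt tc p0; have [s pE ->] := ord_horner_prod Q tt p0; rewrite {1}pE.
rewrite -mul_polyC mupMr ?rootC ?lead_coef_eq0 // mu_prod_XsubC.
elim: s {pE} => [|z s IH]; first by rewrite big_nil mul0r.
rewrite big_cons IH /= PoszD mulrDl; congr (_ + _).
have [->|zc] := eqVneq z c; first by rewrite mul1r.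
rewrite mul0r; have -> : t - z%:A = (c - z)%:A + (t - c%:A).
  by rewrite scalerBl; ring.
have cz0 : (c - z)%:A != 0 :> X.
  by rewrite scaler_eq0 subr_eq0 eq_sym (negPf zc) oner_neq0.
have [|_ ->] := @ordDl _ _ Q (c - z)%:A (t - c%:A) cz0; last exact: ord_cst.
by rewrite ord_cst; right; lia.
Qed.

(** At a pole of [t], each linear factor [t - z] has the order of [t]. *)
Lemma ord_pole_horner Q t p : transcendental t -> ord Q t < 0 -> p != 0 ->
  ord Q (horner_alg t p) = (size p).-1%:Z * ord Q t.
Proof.
move=> tt tQ p0; have [s pE ->] := ord_horner_prod Q tt p0; rewrite {1}pE.
rewrite size_scale ?lead_coef_eq0 // size_prod_XsubC /=.
elim: s {pE} => [|z s IH]; first by rewrite big_nil mul0r.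
have tn0 : t != 0 by apply: contraTneq tQ => ->; rewrite ord0.
rewrite big_cons IH /= -addn1 PoszD mulrDl mul1r addrC; congr (_ + _).
rewrite -scaleNr; have [|_ -> //] := @ordDl _ _ Q t (- z)%:A tn0.
by apply: vgeW (vge_cst Q _); lia.
Qed.

(** All orders at [Q] are multiples of that of [t - c], and the order 1 occurs. *)
Lemma ord_gen1 Q t c : generates t -> 0 < ord Q (t - c%:A) ->
  ord Q (t - c%:A) = 1.
Proof.
move=> [tt tg] tc; have [f f1] := ord_onto Q.
have [p [q [q0 fE]]] := tg f.
have p0 : horner_alg t p != 0.
  by apply: contra_eq_neq f1 => p0; rewrite fE p0 mul0r ord0.
move: f1; rewrite fE ordM ?invr_eq0 // ordV.
rewrite !(ord_horner tt tc) ?(@horner_alg_neq0 t) // -mulrBl => e1.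
have : (ord Q (t - c%:A) %| 1)%Z.
  by apply/dvdzP; exists ((mup c p)%:Z - (mup c q)%:Z).
by rewrite dvdz1; lia.
Qed.

Lemma ord_gen Q t c p q : generates t -> 0 < ord Q (t - c%:A) ->
  p != 0 -> q != 0 ->
  ord Q (horner_alg t p / horner_alg t q) = (mup c p)%:Z - (mup c q)%:Z.
Proof.
move=> tg tc p0 q0; rewrite ordM ?invr_eq0 ?(tg.1 _ _) // ordV.
by rewrite !(ord_horner tg.1 tc) // (ord_gen1 tg tc); lia.
Qed.

Lemma place_ext Q Q' : ord Q =1 ord Q' -> Q = Q'.
Proof.
case: Q Q' => [v a b c d e] [v' a' b' c' d' e'] /= vv'.
have {}vv' : v = v' by exact: functional_extensionality_dep.
by case: v' / vv' a' b' c' d' e' => *; congr Place; exact: Prop_irrelevance.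
Qed.

(** The order of a fraction in [t] is a difference of multiplicities at [c], which determines the
    valuation. *)
Lemma place_gen_inj Q Q' t c : generates t ->
  0 < ord Q (t - c%:A) -> 0 < ord Q' (t - c%:A) -> Q = Q'.
Proof.
move=> tg Qc Qc'; apply: place_ext => f.
have [p [q [q0 ->]]] := tg.2 f.
have [->|p0] := eqVneq p 0; first by rewrite rmorph0 mul0r !ord0.
by rewrite !(ord_gen tg (c := c)) // (horner_alg_neq0 q0).
Qed.

(** * The place of a rational curve at t = c *)

Section PlaceAt.
Variables (t : X) (c : k).
Hypothesis tg : generates t.

Definition num f := sval (cid (tg.2 f)).
Definition den f := sval (cid (svalP (cid (tg.2 f)))).

Lemma den_neq0 f : den f != 0.
Proof.
by apply: (@horner_alg_neq0 t); have [] := svalP (cid (svalP (cid (tg.2 f)))).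
Qed.

Lemma num_den f : f = horner_alg t (num f) / horner_alg t (den f).
Proof. by have [] := svalP (cid (svalP (cid (tg.2 f)))). Qed.

Lemma num_neq0 f : f != 0 -> num f != 0.
Proof.
apply: contraNneq => f0; by rewrite (num_den f) f0 rmorph0 mul0r.
Qed.

Definition ord_at f : int :=
  if f == 0 then 0 else (mup c (num f))%:Z - (mup c (den f))%:Z.

(** Independence of the chosen fraction, which need not be reduced: transcendence of [t] lifts the
    cross-multiplied equality to polynomials, where multiplicities add up. *)
Lemma ord_atE f p q : p != 0 -> q != 0 ->
  f = horner_alg t p / horner_alg t q ->
  ord_at f = (mup c p)%:Z - (mup c q)%:Z.
Proof.
move=> p0 q0 fE.
have f0 : f != 0 by rewrite fE mulf_neq0 ?invr_eq0 // (tg.1 _ _).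
rewrite /ord_at (negPf f0).
have e : num f * q = p * den f.
  apply/eqP; rewrite -subr_eq0; apply: contraT => /tg.1/eqP[].
  rewrite rmorphB !rmorphM /=; have := num_den f; rewrite {1}fE.
  move/eqP; rewrite eqr_div ?(tg.1 _ _) ?den_neq0 // => /eqP ->.
  by rewrite subrr.
have := congr1 (mup c) e.
by rewrite !mupM ?den_neq0 ?num_neq0 //; lia.
Qed.

Lemma ord_at0 : ord_at 0 = 0. Proof. by rewrite /ord_at eqxx. Qed.

Lemma ord_at_cst (a : k) : ord_at a%:A = 0.
Proof.
have [->|a0] := eqVneq a 0; first by rewrite scale0r ord_at0.
rewrite (@ord_atE _ a%:P 1) ?polyC_eq0 ?oner_neq0 //.
  by rewrite !mupNroot ?rootC ?oner_neq0.
by rewrite horner_algC rmorph1 divr1.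
Qed.

Lemma ord_atM f h : f != 0 -> h != 0 -> ord_at (f * h) = ord_at f + ord_at h.
Proof.
move=> f0 h0; rewrite (@ord_atE _ (num f * num h) (den f * den h)).
- by rewrite /ord_at (negPf f0) (negPf h0) !mupM ?den_neq0 ?num_neq0 //; lia.
- by rewrite mulf_neq0 ?num_neq0.
- by rewrite mulf_neq0 ?den_neq0.
- by rewrite {1}(num_den f) {1}(num_den h) !rmorphM mulf_div.
Qed.

Lemma ord_atD f h : f != 0 -> h != 0 -> f + h != 0 ->
  Num.min (ord_at f) (ord_at h) <= ord_at (f + h).
Proof.
move=> f0 h0 fh0; pose N := num f * den h + num h * den f.
have fhE : f + h = horner_alg t N / horner_alg t (den f * den h).
  rewrite {1}(num_den f) {1}(num_den h) rmorphD !rmorphM /= addf_div //;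
  by rewrite ?(tg.1 _ _) ?den_neq0.
have N0 : N != 0.
  by apply: contraNneq fh0 => N0; rewrite fhE N0 rmorph0 mul0r.
rewrite (ord_atE N0 _ fhE) ?mulf_neq0 ?den_neq0 //.
(* Both terms of [N] are divisible by the smaller power of ['X - c%:P]. *)
have : (minn (mup c (num f * den h)) (mup c (num h * den f)) <= mup c N)%N.
  rewrite mup_geq // dvdp_add // -mup_geq ?mulf_neq0 ?num_neq0 ?den_neq0 //.
    exact: geq_minl.
  exact: geq_minr.
rewrite /ord_at (negPf f0) (negPf h0) !mupM ?den_neq0 ?num_neq0 //.
by rewrite ge_min; lia.
Qed.

Lemma ord_at_gen : ord_at (t - c%:A) = 1.
Proof.
rewrite (@ord_atE _ ('X - c%:P) 1) ?polyXsubC_eq0 ?oner_neq0 //.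
  by rewrite (@mup_XsubCX _ 1) eqxx mupNroot ?rootC ?oner_neq0.
by rewrite rmorphB /= horner_algC horner_algX rmorph1 divr1.
Qed.

Definition place_at : place X :=
  Place ord_at0 ord_at_cst ord_atM ord_atD (ex_intro _ _ ord_at_gen).

End PlaceAt.

Lemma ord_place_at t c (tg : generates t) : ord (place_at c tg) (t - c%:A) = 1.
Proof. exact: ord_at_gen. Qed.

Lemma place_at_regular Q t c : 0 < ord Q (t - c%:A) -> vge Q 0 t.
Proof.
move=> tc; rewrite -[t](subrK c%:A); apply: vgeD (vge_cst Q c).
by right; apply: ltW.
Qed.

Lemma regular_place_at Q t : generates t -> 0 <= ord Q t ->
  exists c : k, 0 < ord Q (t - c%:A).
Proof.
move=> tg tQ; have [c tc] : exists c : k, vge Q 1 (t - c%:A).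
  by apply: residue_exists; right.
exists c; have := vgeE _ tc; rewrite subr_eq0; apply.
by have /transcendentalP := tg.1.
Qed.

(** A root [c] of the reduced denominator would be a pole of [f] at the place [t = c], where [t] is
    regular; hence the denominator is constant. *)
Lemma pole_free t f : generates t ->
  (forall Q, 0 <= ord Q t -> vge Q 0 f) -> exists p, f = horner_alg t p.
Proof.
move=> tg fQ; have [p [q [cpq q0 fE]]] := in_ratfun_coprime (tg.2 f).
have qn0 := horner_alg_neq0 q0.
have [/eqP/size_poly1P[a a0 qa]|/closed_rootP[c qc]] := eqVneq (size q) 1.
  exists (a^-1 *: p); rewrite fE qa horner_algC linearZ /= mulrC.
  by rewrite -(fmorphV (in_alg X)).
have pc : ~~ root p c.
  by apply: contraTN qc; apply: coprimep_root.
have p0 : p != 0 by apply: contraNneq pc => ->; rewrite root0.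
have Pt := ord_place_at c tg.
have Pt0 : 0 <= ord (place_at c tg) t.
  apply: (vgeE _ (place_at_regular (c := c) _)); rewrite ?Pt //.
  by have /transcendentalP/(_ 0) := tg.1; rewrite scale0r.
have := vgeE _ (fQ _ Pt0).
rewrite fE mulf_eq0 invr_eq0 negb_or (tg.1 _ p0) q0 => /(_ isT).
rewrite (@ord_gen _ _ c) ?Pt // (mupNroot pc).
by move: qc; rewrite -dvdp_XsubCl XsubC_dvd //; lia.
Qed.

End RationalCurves.

(** * Differentials on a rational curve *)

Section RationalDifferentials.
Variables (k : closedFieldType) (X : curve k).
Hypothesis pchar_k : [pchar k] =i pred0.
Implicit Types (f g h t u : X) (p q : {poly k}) (Q : place X).

Lemma der_horner_alg (d : derivation X) t p :
  d (horner_alg t p) = horner_alg t p^`() * d t.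
Proof.
elim/poly_ind: p => [|p c IH]; first by rewrite deriv0 !rmorph0 der0 mul0r.
rewrite derivMXaddC !rmorphD !rmorphM /= horner_algC horner_algX derD der_cst.
by rewrite derM IH; ring.
Qed.

(** In lowest terms the denominator of [f] does not vanish at [c], and the quotient rule only
    squares it. *)
Lemma ord_der_regular (d : derivation X) Q t c f :
  generates t -> 0 < ord Q (t - c%:A) -> d t != 0 ->
  vge Q 0 f -> vge Q 0 (d f / d t).
Proof.
move=> tg tc dt fQ; have t0 := place_at_regular tc.
have [p [q [cpq q0 fE]]] := in_ratfun_coprime (tg.2 f).
have [f0|f0] := eqVneq f 0; first by rewrite f0 der0 mul0r; left.
have qn0 := horner_alg_neq0 q0.
have pn0 : p != 0 by apply: contraNneq f0 => p0; rewrite fE p0 rmorph0 mul0r.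
have qc : mup c q = 0%N.
  have [qc|/mupNroot //] := boolP (root q c).
  have pc : ~~ root p c by apply: contraTN qc; apply: coprimep_root.
  have := vgeE f0 fQ; rewrite fE (ord_gen tg tc pn0 qn0) (mupNroot pc); lia.
have qord : ord Q (horner_alg t q) = 0.
  by rewrite (ord_horner tg.1 tc qn0) qc mul0r.
have -> : d f / d t = (horner_alg t (p^`() * q - p * q^`())) *
                      (horner_alg t q ^+ 2)^-1.
  rewrite fE derM (derV _ q0) // !der_horner_alg rmorphB !rmorphM /=.
  by field; apply/andP; split.
rewrite -(addr0 0); apply: vgeM; first exact: vge_horner.
by right; rewrite ordV ordX // qord mul0rn oppr0.
Qed.

(** Says that [dt] has neither zero nor pole at [t = c]. Writing [u = v (t - c)] with [v] a unit,
    [du/dt] is [v] plus a multiple of [t - c]. *)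
Lemma ord_der_unif (d : derivation X) Q t c u :
  generates t -> 0 < ord Q (t - c%:A) -> d t != 0 -> ord Q u = 1 ->
  ord Q (d u / d t) = 0.
Proof.
move=> tg tc dt u1; have t1 := ord_gen1 tg tc.
have s0 : t - c%:A != 0 by apply: contraTneq tc => ->; rewrite ord0.
have u0 : u != 0 by apply: contra_eq_neq u1 => ->; rewrite ord0.
pose v := u / (t - c%:A).
have v0 : v != 0 by rewrite mulf_neq0 ?invr_eq0.
have vo : ord Q v = 0 by rewrite ordM ?invr_eq0 // ordV u1 t1 subrr.
have -> : d u / d t = v + (t - c%:A) * (d v / d t).
  have -> : u = v * (t - c%:A) by rewrite divfK.
  by rewrite derM derD derN der_cst subr0; field.
have [|_ -> //] := @ordDl _ _ Q v ((t - c%:A) * (d v / d t)) v0.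
rewrite vo -t1 addrC; apply: vgeM; first by right.
by apply: ord_der_regular tg tc dt _; right; rewrite vo.
Qed.

(* Such a section f would give a holomorphic differential f^2 w = p(t) dt, but
   dt has a double pole at the pole of t, where p(t) does not vanish. *)
Lemma half_canonical_rational (w : derivation X -> X) d f :
  rational X -> is_kahler w -> w d != 0 ->
  sections (half (ord_diff w)) f -> f = 0.
Proof.
move=> [t tg] wk wd fw; apply/eqP; apply: contraT => f0.
have hol := half_sections_mul pchar_k wk wd fw fw.
have dn0 := kahler_supp wk wd.
have dt := der_neq0 pchar_k tg.1 dn0.
have ff0 : f * f * w d != 0 by rewrite !mulf_neq0.
pose G := f * f * w d / d t.
have G0 : G != 0 by rewrite mulf_neq0 ?invr_eq0.
have ordG Q : ord Q (d (unif Q) / d t) <= ord Q G.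
  have := hol Q.
  by rewrite (ord_diffE pchar_k Q (kahlerZ _ wk) tg.1 ff0) subr_ge0.
(* Where [t] is regular, [dt] has order 0, so [G] has no pole there. *)
have [Q Qt|p GE] := @pole_free _ _ t G tg.
  have [c tc] := regular_place_at tg Qt.
  by right; rewrite -(ord_der_unif tg tc dt (ord_unif Q)) ordG.
have p0 : p != 0 by apply: contraNneq G0 => p0; rewrite GE p0 rmorph0.
(* [Q] is the point at infinity, the zero of [t^-1]. *)
have sg := generatesV tg; pose Q := place_at 0 sg.
have sQ : ord Q (t^-1 - 0%:A) = 1 := ord_place_at 0 sg.
have tn0 : t != 0 by apply: contra_eq_neq sQ => ->; rewrite invr0 scale0r subr0 ord0.
have tQ : ord Q t = -1.
  by move: sQ; rewrite scale0r subr0 ordV; lia.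
have ds := der_neq0 pchar_k sg.1 dn0.
have sQ0 : 0 < ord Q (t^-1 - 0%:A) by rewrite sQ.
have := ordG Q.
(* By the chain rule through [t^-1], the left side has order 2 at [Q], while [G = p(t)] has order at
   most 0. *)
have -> : d (unif Q) / d t = d (unif Q) / d t^-1 * - (t ^+ 2)^-1.
  have -> : - (t ^+ 2)^-1 = d t^-1 / d t.
    by rewrite (derV d tn0); field; apply/andP; split.
  by rewrite mulrA divfK.
have du := der_neq0 pchar_k (unif_transcendental Q) dn0.
rewrite GE (ord_pole_horner tg.1 _ p0) ?tQ // ordM; last 2 first.
- by rewrite mulf_neq0 ?invr_eq0.
- by rewrite oppr_eq0 invr_eq0 expf_neq0.
rewrite (ord_der_unif sg sQ0 ds (ord_unif Q)) ordN ordV ordX // tQ; lia.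
Qed.

End RationalDifferentials.

(** * Sections of O(1) on a rational curve *)

Section DegreeOne.
Variables (k : closedFieldType) (X : curve k).
Implicit Types (f g h t u : X) (D : place X -> int) (p q : {poly k}) (Q : place X).

Lemma sectionsE D f : sections D f <-> forall P, vge P (- D P) f.
Proof.
split=> [[->|Df] P|Df]; first by left.
  by right; have := Df P; lia.
have [->|f0] := eqVneq f 0; first by left.
by right=> P; have := vgeE f0 (Df P); lia.
Qed.

Lemma sections_linear D (c : k) f h :
  sections D f -> sections D h -> sections D (c *: f + h).
Proof.
by rewrite !sectionsE => fD hD P; apply: vgeD (vgeZ c (fD P)) (hD P).
Qed.

Lemma vge_unif Q m n f : vge Q m f <-> vge Q (m + n) (f * unif Q ^ n).
Proof.
have u0 := unif_neq0 Q.
have un : ord Q (unif Q ^ n) = n by rewrite ordXz // ord_unif mul1r.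
have uzn0 : unif Q ^ n != 0 by rewrite expfz_neq0.
split=> fm; first by apply: vgeM => //; right; rewrite un.
have -> : f = f * unif Q ^ n * (unif Q ^ n)^-1 by rewrite mulfK.
by rewrite -(addrK n m); apply: vgeM => //; right; rewrite ordV un.
Qed.

Lemma fibre_value_linear D Q (c : k) f h : sections D f -> sections D h ->
  fibre_value D Q (c *: f + h) = c * fibre_value D Q f + fibre_value D Q h.
Proof.
rewrite !sectionsE => /(_ Q) fD /(_ Q) hD.
rewrite /fibre_value mulrDl -scalerAl value_linear //;
  by rewrite -(addNr (D Q)) -vge_unif.
Qed.

Lemma fibre_value_eq0 D Q f :
  sections D f -> fibre_value D Q f = 0 <-> vge Q (1 - D Q) f.
Proof.
rewrite sectionsE => /(_ Q) fD; rewrite value_eq0.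
  by rewrite (vge_unif Q (1 - D Q) (D Q)) subrK.
by rewrite -(addNr (D Q)) -vge_unif.
Qed.

Lemma vgeMr Q m f h : h != 0 -> vge Q m f <-> vge Q (m + ord Q h) (f * h).
Proof.
move=> h0; split=> fm; first by apply: vgeM => //; right.
have -> : f = f * h * h^-1 by rewrite mulfK.
by rewrite -(addrK (ord Q h) m); apply: vgeM => //; right; rewrite ordV.
Qed.

(** Multiplication by [h] carries O(D) to O(E), which reduces a divisor of degree one to a single
    point. *)
Lemma sections_equiv D E f h : h != 0 -> (forall Q, D Q = E Q + ord Q h) ->
  sections D f <-> forall Q, vge Q (- E Q) (f * h).
Proof.
move=> h0 DE; rewrite sectionsE.
by split=> fD Q; have := fD Q; rewrite (vgeMr _ _ f h0) DE opprD subrK.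
Qed.

Lemma fibre_value_equiv D E Q f h : h != 0 ->
  (forall Q, D Q = E Q + ord Q h) -> sections D f ->
  fibre_value D Q f = 0 <-> vge Q (1 - E Q) (f * h).
Proof.
move=> h0 DE fD; rewrite (fibre_value_eq0 _ fD) (vgeMr _ _ f h0) DE.
by rewrite opprD addrA subrK.
Qed.

(** A point [t = c] is moved to infinity by [(t - c)^-1]; if [Q] is a pole of [t], the generator
    [t^-1] has order 1 there. *)
Lemma rational_pole Q : rational X -> exists2 t, generates t & ord Q t = -1.
Proof.
move=> [t tg]; have [tQ|tQ] := lerP 0 (ord Q t).
  have [c tc] := regular_place_at tg tQ.
  exists (t - c%:A)^-1; first exact: generatesV (generatesB c tg).
  by rewrite ordV (ord_gen1 tg tc).
exists t => //.
have := @ord_gen1 _ _ Q t^-1 0 (generatesV tg).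
by rewrite scale0r subr0 ordV oppr_gt0 => /(_ tQ); lia.
Qed.

(* In a coordinate t with its pole at P, psi is t - t(Q), or 1 if Q = P. *)
Lemma degree_one_vanishing P Q : rational X -> exists psi,
  [/\ forall Q', vge Q' (- pt_divisor P Q') psi,
      forall Q', Q' <> Q -> ~ vge Q' (1 - pt_divisor P Q') psi,
      vge Q (1 - pt_divisor P Q) psi &
      forall g, (forall Q', vge Q' (- pt_divisor P Q') g) ->
        vge Q (1 - pt_divisor P Q) g -> exists b : k, g = b *: psi].
Proof.
move=> Xr; have [t tg tP] := rational_pole P Xr.
have ptP : pt_divisor P P = 1 by rewrite /pt_divisor; case: asboolP.
have ptN Q' : Q' <> P -> pt_divisor P Q' = 0.
  by rewrite /pt_divisor; case: asboolP.
(* No pole besides [P] makes [g] a polynomial in [t]; at most a simple pole at [P] bounds its degree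
   by 1. *)
have poly1 g : (forall Q', vge Q' (- pt_divisor P Q') g) ->
    exists2 p : {poly k}, (size p <= 2)%N & g = horner_alg t p.
  move=> gP; have [Q' Q't|p gE] := @pole_free _ _ t g tg.
    rewrite -oppr0 -(ptN Q'); first exact: gP.
    by move=> Q'P; rewrite Q'P tP in Q't.
  exists p => //; have [->|p0] := eqVneq p 0; first by rewrite size_poly0.
  have := gP P; rewrite ptP gE => /(vgeE (tg.1 _ p0)).
  by rewrite (ord_pole_horner tg.1 _ p0) tP; lia.
have [->|QP] := pselect (Q = P).
  exists 1; split=> [Q'|Q' Q'P|| g gP].
  - right; rewrite ord1; have [->|/ptN ->] := pselect (Q' = P); rewrite ?ptP; lia.
  - by rewrite ptN // => /(vgeE (oner_neq0 _)); rewrite ord1; lia.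
  - by rewrite ptP; right; rewrite ord1.
  rewrite ptP subrr; have [p _ ->] := poly1 g gP.
  have [->|p0] := eqVneq p 0; first by exists 0; rewrite rmorph0 scale0r.
  move=> /(vgeE (tg.1 _ p0)); rewrite (ord_pole_horner tg.1 _ p0) tP // => sp.
  have /size1_polyC -> : (size p <= 1)%N by lia.
  by exists p`_0; rewrite horner_algC.
(* [P] is the only pole of [t], being the only zero of [t^-1]. *)
have tQ' Q' : Q' <> P -> 0 <= ord Q' t.
  move=> Q'P; rewrite leNgt; apply/negP => tQ'; apply: Q'P.
  by apply: (place_gen_inj (c := 0) (generatesV tg)); rewrite scale0r subr0 ordV; lia.
have [c tc] := regular_place_at tg (tQ' Q QP).
have tcP : ord P (t - c%:A) = -1.
  have tn0 : t != 0 by apply: contra_eq_neq tP => ->; rewrite ord0.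
  rewrite -scaleNr; have [|_ -> //] := @ordDl _ _ P t (- c)%:A tn0.
  by apply: vgeW (vge_cst P _); lia.
have tc0 : t - c%:A != 0 by apply: contraTneq tc => ->; rewrite ord0.
exists (t - c%:A); split=> [Q'|Q' Q'Q|| g gP].
- have [->|Q'P] := pselect (Q' = P); first by right; rewrite ptP tcP.
  rewrite ptN // oppr0; apply: vgeB (vge_cst _ _).
  by right; apply: tQ'.
- have [->|Q'P] := pselect (Q' = P).
    by rewrite ptP => /(vgeE tc0); rewrite tcP; lia.
  rewrite ptN // => /(vgeE tc0) tcQ'; apply: Q'Q.
  by apply: (place_gen_inj tg _ tc); apply: lt_le_trans tcQ'.
- by rewrite ptN // subr0; right; lia.
rewrite ptN // subr0; have [p sp ->] := poly1 g gP.
have [->|p0] := eqVneq p 0; first by exists 0; rewrite rmorph0 scale0r.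
move=> /(vgeE (tg.1 _ p0)); rewrite (ord_horner tg.1 tc p0) (ord_gen1 tg tc).
rewrite mulr1 => mp.
have /dvdpP[r pE] : 'X - c%:P %| p by rewrite XsubC_dvd //; lia.
have r0 : r != 0 by apply: contraNneq p0 => r0; rewrite pE r0 mul0r.
have /size1_polyC rE : (size r <= 1)%N.
  by move: sp; rewrite pE size_Mmonic ?monicXsubC // size_XsubC addn2 /= ltnS.
exists r`_0; rewrite pE {1}rE rmorphM /= horner_algC mulr_algl.
by rewrite rmorphB /= horner_algX horner_algC.
Qed.

Section Evaluation.
Variables (D : place X -> int) (P Q0 Q1 : place X).
Hypotheses (Xr : rational X) (DP : lin_equiv D (pt_divisor P)) (Q01 : Q0 <> Q1).

(** Vanishing at [Q0] makes [f * h] a multiple of [psi], which does not vanish at [Q1]. *)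
Lemma degree_one_eval_inj f : sections D f ->
  fibre_value D Q0 f = 0 -> fibre_value D Q1 f = 0 -> f = 0.
Proof.
have [h h0 DE] := DP; move=> fD.
rewrite !(fibre_value_equiv _ h0 DE fD) => f0 f1.
have [psi [_ psiN _ psiP]] := degree_one_vanishing P Q0 Xr.
have [|//|b fE] := psiP (f * h); first exact/(sections_equiv _ h0 DE).
have [b0|b0] := eqVneq b 0.
  by move: fE => /eqP; rewrite b0 scale0r mulf_eq0 (negPf h0) orbF => /eqP.
case: (psiN Q1); first by move=> Q10; apply: Q01.
have -> : psi = b^-1 *: (f * h) by rewrite fE scalerK.
exact: vgeZ.
Qed.

Lemma degree_one_separates (Q Q' : place X) : Q' <> Q ->
  exists f, [/\ sections D f, fibre_value D Q f = 0 & fibre_value D Q' f = 1].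
Proof.
move=> QQ'; have [h h0 DE] := DP.
have [psi [psiP psiN psiQ _]] := degree_one_vanishing P Q Xr.
pose f := psi / h; have fh : f * h = psi by rewrite divfK.
have fD : sections D f by apply/(sections_equiv _ h0 DE); rewrite fh.
have fQ : fibre_value D Q f = 0.
  by apply/(fibre_value_equiv _ h0 DE fD); rewrite fh.
have fQ' : fibre_value D Q' f != 0.
  by apply/eqP => /(fibre_value_equiv _ h0 DE fD); rewrite fh; exact: psiN.
have s0 : sections D 0 by left.
have v0 R : fibre_value D R 0 = 0.
  by rewrite (fibre_value_eq0 _ s0); left.
exists ((fibre_value D Q' f)^-1 *: f + 0).
split; first exact: sections_linear.
- by rewrite fibre_value_linear // fQ v0 mulr0 addr0.
- by rewrite fibre_value_linear // v0 addr0 mulVf.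
Qed.

(** Lagrange interpolation: combine two sections, each vanishing at one point and equal to 1 at the
    other. *)
Lemma degree_one_eval_surj (a0 a1 : k) : exists f,
  [/\ sections D f, fibre_value D Q0 f = a0 & fibre_value D Q1 f = a1].
Proof.
have [f [fD f0 f1]] := degree_one_separates (not_eq_sym Q01).
have [h [hD h1 h0]] := degree_one_separates Q01.
have s0 : sections D 0 by left.
have v0 R : fibre_value D R 0 = 0.
  by rewrite (fibre_value_eq0 _ s0); left.
have ahD : sections D (a0 *: h + 0) by apply: sections_linear.
exists (a1 *: f + (a0 *: h + 0)); split; first exact: sections_linear.
  by rewrite !fibre_value_linear // f0 h0 v0 mulr0 mulr1 add0r addr0.
by rewrite !fibre_value_linear // f1 h1 v0 mulr0 mulr1 !addr0.
Qed.

End Evaluation.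
End DegreeOne.

(** * Dimensions *)

Section Dimension.
Variable k : fieldType.

Definition has_basis (V : lmodType k) (S : set V) (n : nat) :=
  exists b : 'I_n -> V, is_basis S b.

Lemma basis_coord (V : lmodType k) (S : set V) n (b : 'I_n -> V) p
    (u : 'I_p -> V) : is_basis S b -> (forall i, S (u i)) ->
  exists A : 'M[k]_(p, n), forall i, u i = \sum_(j < n) A i j *: b j.
Proof.
move=> [_ bP] uS; have coord i : exists a : 'rV[k]_n, u i = \sum_(j < n) a 0 j *: b j.
  by have [a [aE _]] := bP _ (uS i); exists a.
have [a aE] := choice coord; exists (\matrix_(i, j) a i 0 j) => i.
by rewrite {1}aE; apply: eq_bigr => j _; rewrite mxE.
Qed.

(** Uniqueness of coordinates makes the product of the two change-of-basis matrices the identity. *)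
Lemma basis_leq (V : lmodType k) (S : set V) m n :
  has_basis S m -> has_basis S n -> (m <= n)%N.
Proof.
move=> [b [bS bP]] [b' [bS' bP']].
have [A AE] := basis_coord (conj bS' bP') bS.
have [B BE] := basis_coord (conj bS bP) bS'.
suff AB1 : A *m B = 1%:M by exact: mulmx1_min AB1.
apply/row_matrixP => i; have [a [_ aU]] := bP _ (bS i).
rewrite -[LHS]aU; last first.
  rewrite {1}AE; under eq_bigr do rewrite {1}BE scaler_sumr.
  rewrite exchange_big; apply: eq_bigr => j _ /=.
  rewrite !mxE scaler_suml; apply: eq_bigr => l _.
  by rewrite scalerA.
apply: aU; rewrite (bigD1 i) //= !mxE eqxx scale1r big1 ?addr0 // => j ji.
by rewrite !mxE eq_sym (negPf ji) scale0r.
Qed.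

Lemma dimE (V : lmodType k) (S : set V) n : has_basis S n -> dim S = n.
Proof.
move=> Sn; rewrite /dim; case: xgetP => [m _ /= Sm|/(_ n)]; last by case.
by apply/eqP; rewrite eqn_leq !(@basis_leq _ S).
Qed.

(** A positive dimension is not the default value, so it certifies finite dimension; positivity of
    the genus is exploited through this. *)
Lemma dim_gt0_basis (V : lmodType k) (S : set V) :
  (0 < dim S)%N -> has_basis S (dim S).
Proof. by rewrite /dim; case: xgetP. Qed.

Definition subspace (V : lmodType k) (S : set V) :=
  S 0 /\ forall (c : k) u v, S u -> S v -> S (c *: u + v).

Definition linear_map (V V' : lmodType k) (phi : V -> V') :=
  forall (c : k) u v, phi (c *: u + v) = c *: phi u + phi v.

Lemma has_basis0 (V : lmodType k) (S : set V) :
  S 0 -> (forall s, S s -> s = 0) -> has_basis S 0.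
Proof.
move=> S0 SP; exists (fun=> 0); split=> [[]//|s /SP ->].
by exists 0; split=> [|a _]; [rewrite big_ord0|apply/rowP; case].
Qed.

(** * Transport of bases along an injective linear map *)

Section LinearMap.
Variables (V V' : lmodType k) (S : set V) (S' : set V') (phi : V -> V').
Hypotheses (subS : subspace S) (phi_lin : linear_map phi).

Lemma subspace_sum (I : Type) (r : seq I) (a : I -> k) (b : I -> V) :
  (forall j, S (b j)) -> S (\sum_(j <- r) a j *: b j).
Proof.
move=> bS; elim/big_ind: _ => [|u v Su Sv|j _]; first exact: subS.1.
  by rewrite -(scale1r u); apply: subS.2.
by rewrite -[X in S X]addr0; apply: subS.2 => //; exact: subS.1.
Qed.

Lemma linear_map0 : phi 0 = 0.
Proof.
have := phi_lin (-1) 0 0; rewrite scaler0 add0r scaleN1r => ->.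
by rewrite addNr.
Qed.

Lemma linear_map_sum (I : Type) (r : seq I) (a : I -> k) (b : I -> V) :
  phi (\sum_(j <- r) a j *: b j) = \sum_(j <- r) a j *: phi (b j).
Proof.
elim: r => [|j r IH]; first by rewrite !big_nil linear_map0.
by rewrite !big_cons phi_lin IH.
Qed.

Hypothesis phiS : forall s, S s -> S' (phi s).
Hypothesis phi_inj : forall s, S s -> phi s = 0 -> s = 0.

Lemma linear_map_inj u v : S u -> S v -> phi u = phi v -> u = v.
Proof.
move=> Su Sv uv; apply/eqP; rewrite -subr_eq0; apply/eqP.
have e : u - v = -1 *: v + u by rewrite scaleN1r addrC.
rewrite e; apply: phi_inj; first exact: subS.2.
by rewrite phi_lin uv scaleN1r addNr.
Qed.

Lemma has_basis_iso n : (forall s', S' s' -> exists2 s, S s & phi s = s') ->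
  has_basis S n <-> has_basis S' n.
Proof.
move=> phi_surj; split=> [[b [bS bP]]|[b' [bS' bP']]].
  exists (phi \o b); split=> [j|s' /phi_surj[s Ss <-]]; first exact: phiS.
  have [a [sE aU]] := bP s Ss; exists a; split=> [|a' sE'].
    by rewrite sE linear_map_sum.
  apply: aU; apply: linear_map_inj => //; first exact: subspace_sum.
  by rewrite linear_map_sum.
have lift j : exists v, S v /\ phi v = b' j.
  by have [v Sv vE] := phi_surj _ (bS' j); exists v.
have [b bE] := choice lift.
exists b; split=> [j|s Ss]; first by have [] := bE j.
have phib (a : 'rV[k]_n) :
    phi (\sum_(j < n) a 0 j *: b j) = \sum_(j < n) a 0 j *: b' j.
  by rewrite linear_map_sum; apply: eq_bigr => j _; have [_ ->] := bE j.
have [a [sE aU]] := bP' _ (phiS Ss).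
exists a; split=> [|a' sE']; last by apply: aU; rewrite -phib -sE'.
apply: linear_map_inj => //; last by rewrite phib.
by apply: subspace_sum => j; have [] := bE j.
Qed.

(** Both sides admit the same basis sizes, so the equality also covers the default value of
    [dim]. *)
Lemma dim_iso : (forall s', S' s' -> exists2 s, S s & phi s = s') ->
  dim S = dim S'.
Proof.
move=> phi_surj; rewrite /dim; congr xget; apply/seteqP.
by split=> n /(has_basis_iso n phi_surj).
Qed.

(* A maximal linearly independent set of coordinate vectors of elements of S
   gives a basis of S. *)
Lemma has_basis_sub m : has_basis S' m -> exists n, has_basis S n.
Proof.
move=> [b [bS bP]].
pose W (a : 'rV[k]_m) := exists2 s, S s & phi s = \sum_(j < m) a 0 j *: b j.
pose indep n := `[< exists A : 'M[k]_(n, m), row_free A /\ forall i, W (row i A) >].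
have indep0 : exists n, indep n.
  exists 0%N; apply/asboolP; exists 0; split=> [|[]//].
  by rewrite /row_free mxrank0.
have indep_leq n : indep n -> (n <= m)%N.
  by move=> /asboolP[A [/eqP rA _]]; rewrite -rA; exact: rank_leq_col.
case: (ex_maxnP indep0 indep_leq) => n /asboolP[A [Afree AW]] nmax.
have coordW s : S s -> exists2 x : 'rV[k]_n,
    phi s = \sum_(j < m) (x *m A) 0 j *: b j & True.
  move=> Ss; have [a [aE _]] := bP _ (phiS Ss).
  suff /submxP[x ax] : (a <= A)%MS by exists x; rewrite -?ax.
  (* A coordinate vector outside the row space of [A] would extend the maximal independent
     family. *)
  apply: contraT => aA; suff /nmax : indep (1 + n)%N by rewrite ltnn.
  apply/asboolP; exists (col_mx a A); split; last first.
    move=> i; case: (split_ordP i) => l ->; rewrite ?rowKu ?rowKd //.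
    by exists s => //; rewrite row_id.
  rewrite /row_free eqn_leq rank_leq_row /=.
  rewrite -[X in (X < _)%N](eqP Afree).
  apply: rank_ltmx; rewrite ltmxE col_mx_sub (negPf aA) andbT.
  by have := submx_refl (col_mx a A); rewrite col_mx_sub => /andP[].
have lift i : exists v, S v /\ phi v = \sum_(j < m) A i j *: b j.
  have [v Sv vE] := AW i; exists v; split=> //; rewrite vE.
  by apply: eq_bigr => j _; rewrite mxE.
have [s sP] := choice lift.
have phis (x : 'rV[k]_n) :
    phi (\sum_(i < n) x 0 i *: s i) = \sum_(j < m) (x *m A) 0 j *: b j.
  rewrite linear_map_sum; under eq_bigr do rewrite (sP _).2 scaler_sumr.
  rewrite exchange_big; apply: eq_bigr => j _ /=.
  rewrite !mxE scaler_suml; apply: eq_bigr => l _.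
  by rewrite scalerA.
have sS i : S (s i) := (sP i).1.
exists n, s; split=> // v Sv; have [x xE _] := coordW v Sv.
exists x; split=> [|y vE].
  by apply: linear_map_inj => //; [exact: subspace_sum|rewrite phis].
apply: (row_free_inj Afree); have [a [aE aU]] := bP _ (phiS Sv).
by rewrite -(aU _ xE) (aU (y *m A)) // vE phis.
Qed.

End LinearMap.

Lemma dprod_sumE (I : Type) (V : I -> lmodType k) (J : Type) (r : seq J)
    (s : J -> dprod V) i :
  (\sum_(j <- r) s j) i = \sum_(j <- r) s j i.
Proof. by elim: r => [|j r IH]; rewrite ?big_nil // !big_cons -IH. Qed.

(** The basis vectors of all factors, extended by zero and indexed by the disjoint union [J], form a
    basis of the product. *)
Lemma has_basis_dprod (I : finType) (V : I -> lmodType k)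
    (S : forall i, set (V i)) (n : I -> nat) :
  (forall i, subspace (S i)) -> (forall i, has_basis (S i) (n i)) ->
  has_basis [set s : dprod V | forall i, S i (s i)] (\sum_i n i).
Proof.
move=> subS bex; pose b i := sval (cid (bex i)).
have bP i : is_basis (S i) (b i) := svalP (cid (bex i)).
rewrite /has_basis.
pose J : finType := {i : I & 'I_(n i)}.
pose T i (l : 'I_(n i)) : J := existT (fun i => 'I_(n i)) i l.
have cardJ : #|{: J}| = (\sum_i n i)%N.
  rewrite card_tagged sumnE big_map big_enum.
  by apply: eq_bigr => i _; rewrite card_ord.
rewrite -cardJ.
pose B (x : J) : dprod V := eqtype.dfwith (fun i => 0 : V i) (b (tag x) (tagged x)).
(* In component [i] of a combination, only the vectors coming from the factor [i] survive. *)
have BE (a : J -> k) i : (\sum_(j < #|{: J}|) a (enum_val j) *: B (enum_val j)) i =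
    \sum_(l < n i) a (T i l) *: b i l.
  transitivity (\sum_(x : J) (a x *: B x) i).
    rewrite dprod_sumE [RHS](reindex (fun j : 'I_#|{: J}| => enum_val j)) //.
    exact: onW_bij (enum_val_bij J).
  transitivity (\sum_i' \sum_(l < n i') (a (T i' l) *: B (T i' l)) i).
    rewrite (sig_big_dep (fun=> true) (fun _ _ => true)
      (fun i' l => (a (T i' l) *: B (T i' l)) i)) /=.
    by apply: eq_big => [x|[x l] _].
  rewrite (bigD1 i) //= [X in _ + X]big1 ?addr0 => [|i' i'i].
    apply: eq_bigr => l _; rewrite [LHS](_ : _ = a (T i l) *: B (T i l) i) //.
    by congr (_ *: _); exact: dfwith_in.
  apply: big1 => l _.
  rewrite [LHS](_ : _ = a (T i' l) *: B (T i' l) i) //.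
  by rewrite [B _ _]dfwith_out // scaler0.
exists (fun j => B (enum_val j)); split=> [j i /=|s /= sS].
  rewrite /B; have [<-|ne] := eqVneq (tag (enum_val j)) i.
    by rewrite dfwith_in; apply: (bP _).1.
  by rewrite dfwith_out //; exact: (subS i).1.
have coord i : exists a : 'rV[k]_(n i), s i = \sum_(l < n i) a 0 l *: b i l.
  by have [a [aE _]] := (bP i).2 _ (sS i); exists a.
pose r i := sval (cid (coord i)).
have rE i : s i = \sum_(l < n i) r i 0 l *: b i l := svalP (cid (coord i)).
exists (\row_j r (tag (enum_val j)) 0 (tagged (enum_val j))).
split=> [|a sE].
  apply: functional_extensionality_dep => i.
  under eq_bigr do rewrite mxE.
  by rewrite (BE (fun x => r (tag x) 0 (tagged x))) {1}rE.
apply/rowP => j; rewrite mxE; set x := enum_val j.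
(* Uniqueness is read off in the component [tag x]. *)
have [a' [_ aU]] := (bP (tag x)).2 _ (sS (tag x)).
have /(congr1 (fun M : 'rV_ _ => M 0 (tagged x))) :
    r (tag x) = \row_l a 0 (enum_rank (T _ l)).
  rewrite -(aU _ (rE (tag x))) -[RHS]aU //.
  transitivity ((\sum_(j < #|{: J}|)
      a 0 (enum_rank (enum_val j)) *: B (enum_val j)) (tag x)).
    by under eq_bigr do rewrite enum_valK; rewrite {1}sE.
  rewrite (BE (fun x => a 0 (enum_rank x))).
  by apply: eq_bigr => l _; rewrite mxE.
rewrite mxE => ->; congr (a 0 _).
have -> : T (tag x) (tagged x) = x by case: (x).
exact: enum_valK.
Qed.

End Dimension.

(** * Limit spin structures *)

Arguments restr {k G C} _ v P.
Arguments glue {k G C} _ e.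
Arguments branch {k G} _ e b.

Section Sections.
Variables (k : closedFieldType) (X : curve k).

Lemma subspace_sections (D : place X -> int) : subspace (sections D).
Proof. by split=> [|c u v]; [left|exact: sections_linear]. Qed.

Lemma has_basis_sections_equiv (D D' : place X -> int) n : lin_equiv D D' ->
  has_basis (sections D) n <-> has_basis (sections D') n.
Proof.
move=> [h h0 DD'].
apply: (has_basis_iso (phi := fun f => f * h)).
- exact: subspace_sections.
- by move=> c u v; rewrite mulrDl scalerAl.
- by move=> f /(sections_equiv _ h0 DD') fD; apply/sectionsE.
- by move=> f _ /eqP; rewrite mulf_eq0 (negPf h0) orbF => /eqP.
move=> f /sectionsE fD; exists (f / h); last by rewrite divfK.
by apply/(sections_equiv _ h0 DD') => Q; rewrite divfK.
Qed.

Hypothesis pchar_k : [pchar k] =i pred0.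

(* Multiplication by a nonzero section of a theta characteristic embeds its
   sections into the holomorphic differentials. *)
Lemma has_basis_half_canonical (w : derivation X -> X) d :
  (0 < genus X)%N -> is_kahler w -> w d != 0 ->
  exists n, has_basis (sections (half (ord_diff w))) n.
Proof.
move=> gX wk wd; set S := sections _.
have [S0|/existsNP[f0 /not_implyP[Sf0 /eqP f0n0]]] :=
    pselect (forall f, S f -> f = 0).
  by exists 0%N; apply: has_basis0 => //; left.
(* The target is the space of holomorphic differentials, whose dimension is the positive genus. *)
apply: (has_basis_sub (phi := fun f => fun d' : derivation X => f * f0 * w d')
  (subspace_sections _) _ _ _ (dim_gt0_basis gX)).
- move=> c u v; apply: functional_extensionality_dep => d'.
  by rewrite /= !mulrDl -!scalerAl.
- move=> f Sf /=; split; first exact: kahlerZ.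
  exact: half_sections_mul wk wd Sf Sf0.
- move=> f _ /(congr1 (fun g => g d)) /= /eqP.
  by rewrite !mulf_eq0 (negPf f0n0) (negPf wd) !orbF => /eqP.
Qed.

End Sections.

(** * Global sections over the curve with exceptional components *)

Section LimitSpin.
Variables (k : closedFieldType) (G : graph) (C : nodal_curve k G).
Variables (E : edge G -> exc_comp k) (L : line_bundle (blowup C E)).
Hypothesis degree_one : forall e : edge G, exists P : place (E e),
  @lin_equiv _ (E e) (restr L (inr e)) (pt_divisor P).

Lemma exc_pt_neq e : exc_pt (E e) false <> exc_pt (E e) true.
Proof. by move/(@exc_pt_inj _ (E e)). Qed.

Lemma subspace_glob_sections : subspace (glob_sections L).
Proof.
split=> [|c u v [uS uG] [vS vG]]; split.
- by move=> v; left.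
- have v0 v (Q : place (blowup C E v)) : fibre_value (restr L v) Q 0 = 0.
    by apply/fibre_value_eq0; left.
  by move=> e; rewrite !v0 mulr0.
- by move=> x; exact: sections_linear (uS x) (vS x).
- move=> e; rewrite [LHS](fibre_value_linear _ _ (uS _) (vS _)).
  rewrite [X in _ = _ * X](fibre_value_linear _ _ (uS _) (vS _)).
  by rewrite uG vG; ring.
Qed.

(* A section of O(1) on an exceptional component is determined by its values at
   the two nodes, which can be prescribed freely. *)
Lemma nodal_h0_dprod : nodal_h0 L =
  dim [set s : dprod (fun v => C v : lmodType k) |
       forall v, sections (restr L (inl v)) (s v)].
Proof.
apply: (dim_iso (phi := fun s : dprod (fun v => blowup C E v : lmodType k) =>
  (fun v => s (inl v)) : dprod (fun v => C v : lmodType k))).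
- exact: subspace_glob_sections.
- by [].
- by move=> s [sS _] v; exact: sS.
- move=> s [sS sG] s0; apply: functional_extensionality_dep => -[v|e].
    exact: (congr1 (fun t : dprod (fun v => C v : lmodType k) => t v) s0).
  have [P eP] := degree_one e.
  have val0 b : fibre_value (restr L (inr e)) (exc_pt (E e) b) (s (inr e)) = 0.
    have := sG (e, b); rewrite /= => ->.
    have -> : s (inl (ends e b)) = 0.
      exact: (congr1 (fun t : dprod (fun v => C v : lmodType k) => t _) s0).
    rewrite [X in _ * X](_ : _ = 0) ?mulr0 //.
    by apply/fibre_value_eq0; left.
  exact: (degree_one_eval_inj (exc_rational (E e)) eP (@exc_pt_neq e) (sS (inr e))).
move=> s' /= s'S.
(* The value that the gluing imposes on the exceptional component at the node [(e, b)]. *)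
pose a e b := glue L (e, b) *
  fibre_value (restr L (inl (ends e b))) (branch C e b) (s' (ends e b)).
have lift e : exists f : E e, [/\ sections (restr L (inr e)) f,
    fibre_value (restr L (inr e)) (exc_pt (E e) false) f = a e false &
    fibre_value (restr L (inr e)) (exc_pt (E e) true) f = a e true].
  have [P eP] := degree_one e.
  exact: (degree_one_eval_surj (exc_rational (E e)) eP (@exc_pt_neq e)).
pose s : dprod (fun v => blowup C E v : lmodType k) := fun v =>
  match v with inl v => s' v | inr e => sval (cid (lift e)) end.
exists s => //; split=> [[v|e]|[e b]]; first exact: s'S.
  by have [] := svalP (cid (lift e)).
by have [_ h0 h1] := svalP (cid (lift e)); case: b.
Qed.

Lemma nodal_h0_sum (n : vert G -> nat) :
  (forall v, has_basis (sections (restr L (inl v))) (n v)) ->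
  nodal_h0 L = (\sum_v n v)%N.
Proof.
move=> nP; rewrite nodal_h0_dprod; apply: dimE.
exact: (has_basis_dprod (fun v => subspace_sections (restr L (inl v))) nP).
Qed.

End LimitSpin.

Lemma pchar_complex (R : realType) : [pchar R[i]] =i pred0.
Proof. exact: pchar_num. Qed.

Local Close Scope classical_set_scope.
Local Close Scope ring_scope.

Theorem lemma4p9 (R : realType) (g n : nat) (mu : 'I_n -> nat)
    (mu_sig : is_signature g mu) (mu_even : forall i, ~~ odd (mu i))
    (cfg : config n) (cfg_adm : admissible cfg mu)
    (C : twisted_curve R[i] (dual_graph cfg) n)
    (C_boundary : principal_boundary g mu C)
    (C_even : forall e : edge (dual_graph cfg), ~~ separating e ->
       forall b : bool, (2 %| node_order C e b)%Z)
    (E : edge (dual_graph cfg) -> exc_comp R[i])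
    (L : line_bundle (blowup C E)) (L_spin : is_limit_spin L) :
  nodal_parity L =
    \sum_(i < nblock cfg) parity (tw_diff C (inl i)) %[mod 2].
Proof.
have [[genusC _ rationalC] _ _ _] := C_boundary; have [LC LE] := L_spin.
have char0 := @pchar_complex R.
(* Bases are recorded, not mere values of [dim]: summing dimensions requires each space to be
   finite-dimensional. *)
have basisC v : has_basis (sections (half (ord_diff (tw_diff C v))))
    (if v is inl i then h0 (half (ord_diff (tw_diff C v))) else 0%N).
  have [d wd] := @tw_diff_neq0 _ _ _ C v.
  have wk := diff_kahler (tw_diff C v).
  case: v d wd wk => [i|s] d wd wk.
    have [m mP] := has_basis_half_canonical char0 (genusC i) wk wd.
    by rewrite /h0 (dimE mP).
  apply: has_basis0; first by left.
  by move=> f; apply: half_canonical_rational (rationalC s) wk wd.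
rewrite /nodal_parity modn_mod (nodal_h0_sum LE (n := fun v =>
  if v is inl i then h0 (half (ord_diff (tw_diff C v))) else 0%N)); last first.
  by move=> v; apply/(has_basis_sections_equiv _ (LC v)).
rewrite big_sumType /= [X in (_ + X)%N]big1 // addn0.
(* Each [parity] is already a remainder modulo 2. *)
by rewrite -modn_summ.
Qed.
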